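(* Let $n\geq 2$, let $A\in\mathbb{Z}^{m\times n}$ be an integral matrix of full column rank, let $\alpha\in\mathbb{Z}^n\setminus\{0\}$, $b\in\mathbb{Z}^m$ and $c\in\mathbb{Q}^n$. Let $x^*$ be an optimal vertex of the linear program $\max\{c^\top x : Ax\le b,\ x\in\mathbb{R}^n\}$. If the integer program $\max\{c^\top x : Ax\le b,\ x\in\mathbb{Z}^n\}$ is feasible, then it has an optimal solution $z^*$ such that \[ |\alpha^\top(x^*-z^* )|<\frac{4n+2}{9}\cdot\Delta^{\alpha}(A). \]
   Context: For $\alpha\in\mathbb{Z}^n$, $\Delta^{\alpha}(A)$ is the maximum of $\left|\det\begin{pmatrix}\alpha^\top\\ B\end{pmatrix}\right|$ over all $(n-1)\times n$ submatrices $B$ of $A$ (i.e., $B$ consists of $n-1$ rows of $A$). *)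

(* Defs.v *)
From HB Require Import structures.
From mathcomp Require Import all_boot all_order all_algebra.
Set Implicit Arguments. Unset Strict Implicit. Unset Printing Implicit Defensive.
Import Order.TTheory GRing.Theory Num.Theory.
Local Open Scope ring_scope.

Definition intmx (R : realFieldType) (p q : nat) (M : 'M[int]_(p, q)) : 'M[R]_(p, q) :=
  map_mx (fun k : int => k%:~R) M.

Definition feasible (R : realFieldType) (m n : nat) (A : 'M[int]_(m, n))
  (b : 'cV[int]_m) (x : 'cV[R]_n) : Prop :=
  forall i : 'I_m, (intmx R A *m x) i 0 <= (b i 0)%:~R.

Definition obj (R : realFieldType) (n : nat) (c : 'cV[rat]_n) (x : 'cV[R]_n) : R :=
  \sum_(j < n) ratr (c j 0) * x j 0.

Definition tight_rows (R : realFieldType) (m n : nat) (A : 'M[int]_(m, n))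
  (b : 'cV[int]_m) (x : 'cV[R]_n) : 'M[R]_(m, n) :=
  \matrix_(i, j) (if (intmx R A *m x) i 0 == (b i 0)%:~R then intmx R A i j else 0).

Definition vertex (R : realFieldType) (m n : nat) (A : 'M[int]_(m, n))
  (b : 'cV[int]_m) (x : 'cV[R]_n) : Prop :=
  feasible A b x /\ \rank (tight_rows A b x) = n.

Definition lp_optimal_vertex (R : realFieldType) (m n : nat) (A : 'M[int]_(m, n))
  (b : 'cV[int]_m) (c : 'cV[rat]_n) (x : 'cV[R]_n) : Prop :=
  vertex A b x /\ forall y : 'cV[R]_n, feasible A b y -> obj c y <= obj c x.

Definition ip_optimal (R : realFieldType) (m n : nat) (A : 'M[int]_(m, n))
  (b : 'cV[int]_m) (c : 'cV[rat]_n) (z : 'cV[int]_n) : Prop :=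
  feasible A b (intmx R z) /\
  forall y : 'cV[int]_n, feasible A b (intmx R y) -> obj c (intmx R y) <= obj c (intmx R z).

Definition dot (R : realFieldType) (n : nat) (alpha : 'cV[int]_n) (x : 'cV[R]_n) : R :=
  \sum_(j < n) (alpha j 0)%:~R * x j 0.

(* Delta^alpha(A) = max over choices of n-1 rows B of A of |det (alpha^T ; B)|.
   Row 0 of the n x n matrix is alpha^T, rows 1..n-1 are rows f 1, ..., f (n-1)
   of A (f 0 is ignored).  Choices with repeated rows give determinant 0. *)
Definition Delta_alpha (m n : nat) (alpha : 'cV[int]_n) (A : 'M[int]_(m, n)) : nat :=
  \max_(f : {ffun 'I_n -> 'I_m})
     `|\det (\matrix_(i < n, j < n)
              (if nat_of_ord i == 0%N then alpha j ord0 else A (f i) j))|%N.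

(* Main.v *)
Require Import Defs.
From HB Require Import structures.
From Stdlib Require Import Classical.
From mathcomp Require Import all_boot all_order all_algebra.
From mathcomp Require Import zify ring lra.
Set Implicit Arguments. Unset Strict Implicit. Unset Printing Implicit Defensive.
Import Order.TTheory GRing.Theory Num.Theory.
Local Open Scope ring_scope.

(* Let d = x* - z* for an integer optimum z* minimising the total slack of the
   rows tight at x*, and sign the rows of A so that d lies in the cone
   C = {x : A x >= 0}.  Since A and b are integral, no nonzero integer u lies in
   [0, p] + {|A x| < 1} for p in C with d - p in C: otherwise z* + u would be
   another optimum with less slack.

   Following an edge path of the polytope C /\ (d - C) from 0 to d shows that d
   splits as p + q with p, q in C on faces of dimensions k and n - k; hence d is
   a sum of points of 3-dimensional (and at most two 2-dimensional) faces.  For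
   a point p of a k-dimensional face, complete alpha and n - k rows vanishing at p
   by k - 1 further rows to a matrix B with |det B| maximal.  Pigeonholing
   translates of {|A x| < 1/2, alpha x = 0} along [0, p] modulo B Z^n bounds
   |alpha p| by |det B| times 2^(k-1) / vol, where vol is the volume of the polar
   of a symmetric set in dimension k - 1 whose minors are at most 1.  That volume
   is 2 for k = 2 and at least 3 for k = 3, giving the factors 1 and 4/3, whose
   sum over the pieces is at most (4n+2)/9. *)

(** * Edge paths on polyhedra *)

Section Polyhedra.
Variable F : realFieldType.

(** The simplex ratio test: [t] is the least [s i / - v i] over the blocking indices, and [j]
    attains it. *)
Lemma ratio_test (I : finType) (s v : I -> F) (i0 : I) :
  (forall i, 0 <= s i) -> v i0 < 0 ->
  exists t j, [/\ 0 <= t, forall i, 0 <= s i + t * v i, v j < 0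
                & s j + t * v j = 0].
Proof.
move=> s_ge0 v0.
case: (arg_minP (fun i => s i / - v i) (v0 : [pred i | v i < 0] i0)).
move=> j /= vj jmin; exists (s j / - v j), j.
have nvj : 0 < - v j by rewrite oppr_gt0.
have t0 : 0 <= s j / - v j by rewrite divr_ge0 // ltW.
split=> //; last by field; rewrite lt_eqF.
move=> i; case: (ltP (v i) 0) => [vi|vi]; last by rewrite addr_ge0 // mulr_ge0.
have nvi : 0 < - v i by rewrite oppr_gt0.
by have := jmin i vi; rewrite ler_pdivlMr // mulrN; lra.
Qed.

Variables n q : nat.
Implicit Types (G : 'M[F]_(n, q)) (J : {set 'I_q}) (x y w : 'rV[F]_n).

(** Columns outside [J] are zeroed rather than deleted, so that the shape does not depend on [J]. *)
Definition colmask G J : 'M[F]_(n, q) := \matrix_(i, j) (if j \in J then G i j else 0).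
Definition ann G J : 'M[F]_n := kermx (colmask G J).

Lemma mul_colmask G J x j : (x *m colmask G J) 0 j = if j \in J then (x *m G) 0 j else 0.
Proof.
rewrite !mxE; case: ifP => jJ; first by apply: eq_bigr => i _; rewrite !mxE jJ.
by rewrite big1 // => i _; rewrite !mxE jJ mulr0.
Qed.

Lemma annP G J x :
  reflect (forall j, j \in J -> (x *m G) 0 j = 0) (x <= ann G J)%MS.
Proof.
apply: (iffP sub_kermxP) => [h j jJ|h].
  by have := mul_colmask G J x j; rewrite h jJ [LHS]mxE.
by apply/rowP => j; rewrite mul_colmask [RHS]mxE; case: ifP => // jJ; apply: h.
Qed.

Lemma ann_subset G J J' : J \subset J' -> (ann G J' <= ann G J)%MS.
Proof.
move=> sJ; apply/rV_subP => x /annP h; apply/annP => j jJ.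
by apply: h; apply: (subsetP sJ).
Qed.

Definition tight G (h : 'rV[F]_q) x : {set 'I_q} := [set j | (x *m G) 0 j == h 0 j].

Lemma in_tight G h x j : (j \in tight G h x) = ((x *m G) 0 j == h 0 j).
Proof. by rewrite inE. Qed.

Lemma in_tight0 G x j : (j \in tight G 0 x) = ((x *m G) 0 j == 0).
Proof. by rewrite inE [X in _ == X]mxE. Qed.

(** Induction on the dimension of the face spanned by [w0]. While it exceeds 1, the span contains
    some [w != 0] with [w *m f = 0]. Pointedness gives [w *m G] a nonzero entry, negative after a
    change of sign, so moving along [w] makes a new constraint tight without changing the value of
    [f]. *)
Lemma extreme_ray G (f : 'cV[F]_n) w0 :
  (forall w, w *m G = 0 -> w = 0) ->
  (forall j, 0 <= (w0 *m G) 0 j) -> 0 < (w0 *m f) 0 0 ->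
  exists w, [/\ forall j, 0 <= (w *m G) 0 j, 0 < (w *m f) 0 0
              & (\rank (ann G (tight G 0 w)) <= 1)%N].
Proof.
move=> pointed.
have [r] := ubnP (\rank (ann G (tight G 0 w0))).
elim: r w0 => // r IH w0 rk w0G w0f.
case: (leqP (\rank (ann G (tight G 0 w0))) 1) => [le1|gt1]; first by exists w0.
set U := ann G (tight G 0 w0) in rk gt1.
have /rowV0Pn[w] : (U :&: kermx f)%MS != 0.
  rewrite -mxrank_eq0; apply: contraTneq gt1 => rk0.
  by rewrite -leqNgt -(mxrank_mul_ker U f) rk0 addn0 rank_leq_col.
rewrite sub_capmx => /andP[wU /sub_kermxP wf] w_neq0.
wlog [j0 wj0] : w wU wf w_neq0 / exists j, (w *m G) 0 j < 0.
  move=> H; have [/existsP[j hj]|nex] := boolP [exists j, (w *m G) 0 j < 0].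
    by apply: (H w) => //; exists j.
  apply: (H (- w)); rewrite ?eqmx_opp ?oppr_eq0 ?mulNmx ?wf ?oppr0 //.
  have /rV0Pn[j hj] : w *m G != 0 by apply: contraNneq w_neq0 => /pointed ->.
  exists j; rewrite mxE oppr_lt0 lt_neqAle eq_sym hj /=.
  by move: nex; rewrite negb_exists => /forallP/(_ j); rewrite -leNgt.
have [t [j [t0 ge0 wj0' eq0]]] := ratio_test w0G wj0.
have E i : ((w0 + t *: w) *m G) 0 i = (w0 *m G) 0 i + t * (w *m G) 0 i.
  by rewrite mulmxDl -scalemxAl !mxE.
apply: (IH (w0 + t *: w)) => [|i|]; first last.
- by rewrite mulmxDl -scalemxAl wf scaler0 addr0.
- by rewrite E.
rewrite ltnS in rk; apply: leq_trans rk; apply: rank_ltmx; rewrite ltmxE.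
apply/andP; split.
  apply: ann_subset; apply/subsetP => i; rewrite !in_tight0 E => /eqP w0i.
  by rewrite w0i (annP _ _ _ wU) ?mulr0 ?addr0 // in_tight0 w0i.
apply/negP => sub; have := submx_trans wU sub; move/annP/(_ j).
rewrite in_tight0 E eq0 eqxx => /(_ isT) wj.
by rewrite wj ltxx in wj0'.
Qed.

Definition polyhedron G (h : 'rV[F]_q) x := forall j, h 0 j <= (x *m G) 0 j.

(** One simplex pivot. The cone of directions feasible for the constraints tight at [x] is pointed
    because [x] is a vertex, and it contains the improving direction [y - x]. An improving extreme
    ray of it is followed until a constraint blocks. *)
Lemma edge_step G h (f : 'cV[F]_n) x y :
  (forall w, (forall j, 0 <= (w *m G) 0 j) -> (w *m f) 0 0 <= 0) ->
  polyhedron G h x -> ann G (tight G h x) = 0 ->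
  polyhedron G h y -> (x *m f) 0 0 < (y *m f) 0 0 ->
  exists x', [/\ polyhedron G h x', ann G (tight G h x') = 0,
     (x *m f) 0 0 < (x' *m f) 0 0
   & (\rank (ann G (tight G h x :&: tight G h x')) <= 1)%N].
Proof.
move=> bounded Qx vx Qy ltf.
set J := tight G h x.
have [||| w [wG wf rk1]] := @extreme_ray (colmask G J) f (y - x).
- by move=> w /sub_kermxP; rewrite -/(ann G J) vx submx0 => /eqP.
- move=> j; rewrite mul_colmask mulmxBl; case: ifP => //; rewrite in_tight => /eqP E.
  by rewrite [X in _ <= X]mxE [X in _ + X]mxE E subr_ge0.
- by rewrite mulmxBl !mxE subr_gt0; move: ltf; rewrite !mxE.
(* An unblocked improving ray would be a recession direction that contradicts [bounded]. *)
have [j0 wj0] : exists j, (w *m G) 0 j < 0.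
  apply/existsP; apply: contraLR wf; rewrite negb_exists -leNgt => /forallP ge0.
  by apply: bounded => j; rewrite leNgt.
have s_ge0 j : 0 <= (x *m G) 0 j - h 0 j by rewrite subr_ge0.
have [t [j [t0 ge0 wj eq0]]] := ratio_test s_ge0 wj0.
have E i : ((x + t *: w) *m G) 0 i = (x *m G) 0 i + t * (w *m G) 0 i.
  by rewrite mulmxDl -scalemxAl !mxE.
have jJ : j \notin J.
  by apply/negP => jJ; have := wG j; rewrite mul_colmask jJ leNgt wj.
have tpos : 0 < t.
  rewrite lt_neqAle t0 andbT; apply: contraNneq jJ => t_eq0.
  by rewrite in_tight -subr_eq0 -eq0 -t_eq0 mul0r addr0.
set x' := x + t *: w; set J' := tight G h x'.
have rkJ : (\rank (ann G (J :&: J')) <= 1)%N.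
  apply: leq_trans rk1; apply: mxrankS; apply/rV_subP => v /annP hv.
  apply/annP => i; rewrite in_tight0 !mul_colmask; case: ifP => // iJ /eqP wi.
  apply: hv; rewrite inE iJ in_tight E wi mulr0 addr0.
  by rewrite -in_tight.
exists x'; split=> //.
- by move=> i; have := ge0 i; rewrite E; lra.
(* The constraints shared by [x] and [x'] leave only the line of [w], and the new tight constraint
   [j] does not vanish on [w]. *)
- apply/eqP/rowV0P => v vJ'.
  have vJ : (v <= ann G (J :&: J'))%MS.
    by apply: submx_trans vJ' _; apply: ann_subset; apply: subsetIr.
  have wJ : (w <= ann G (J :&: J'))%MS.
    apply/annP => i; rewrite inE !in_tight E => /andP[/eqP-> /eqP h0].
    have : t * (w *m G) 0 i = 0 by lra.
    by move/eqP; rewrite mulf_eq0 (gt_eqF tpos) => /eqP.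
  have w_neq0 : w != 0 by apply: contraTneq wf => ->; rewrite mul0mx mxE ltxx.
  have Jw : (ann G (J :&: J') <= w)%MS.
    have [rw eqw] := mxrank_leqif_sup wJ.
    by rewrite -eqw eqn_leq rw rank_rV w_neq0.
  have /sub_rVP[a va] := submx_trans vJ Jw.
  have /eqP : (v *m G) 0 j = 0.
    by apply: (annP _ _ _ vJ'); rewrite in_tight E; apply/eqP; lra.
  rewrite va -scalemxAl mxE.
  by rewrite mulf_eq0 (lt_eqF wj) orbF => /eqP->; rewrite scale0r.
- by rewrite mulmxDl -scalemxAl !mxE; move: wf; rewrite !mxE => wf;
  rewrite ltrDl mulr_gt0.
Qed.

Lemma vertex_uniq G h x y :
  ann G (tight G h x) = 0 -> tight G h x = tight G h y -> x = y.
Proof.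
move=> vx E; apply/eqP; rewrite -subr_eq0 -submx0 -vx; apply/annP => j jx.
have /eqP xj : (x *m G) 0 j == h 0 j by rewrite -in_tight.
have /eqP yj : (y *m G) 0 j == h 0 j by rewrite -in_tight -E.
by rewrite mulmxBl [LHS]mxE [X in _ + X]mxE xj yj subrr.
Qed.

(* The improving edge path from [x0] to the maximiser [y] either keeps [P] or
   has a step at which [P] is lost; it terminates because a vertex is
   determined by its tight set. *)
Lemma edge_path G h (f : 'cV[F]_n) (P : pred 'rV[F]_n) x0 y :
  (forall w, (forall j, 0 <= (w *m G) 0 j) -> (w *m f) 0 0 <= 0) ->
  polyhedron G h x0 -> ann G (tight G h x0) = 0 -> P x0 ->
  polyhedron G h y ->
  exists x, [/\ polyhedron G h x, P x &
     (y *m f) 0 0 <= (x *m f) 0 0 \/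
     exists x', [/\ polyhedron G h x', ~~ P x'
       & (\rank (ann G (tight G h x :&: tight G h x')) <= 1)%N]].
Proof.
move=> bounded Qx vx Px Qy.
(* [V] records the tight sets of the vertices visited so far. All of them have smaller value than
   [x], so [V] grows at each step inside a finite set. *)
pose below (V : {set {set 'I_q}}) x := forall z, ann G (tight G h z) = 0 ->
  tight G h z \in V -> (z *m f) 0 0 < (x *m f) 0 0.
have : below set0 x0 by move=> z _; rewrite inE.
have [r] := ubnP (#|{set 'I_q}| - #|(set0 : {set {set 'I_q}})|).
elim: r x0 set0 Qx vx Px => // r IH x V Qx vx Px leV bV.
case: (leP ((y *m f) 0 0) ((x *m f) 0 0)) => [le|lt].
  by exists x; split=> //; left.
have [x' [Qx' vx' ltx' rk]] := edge_step bounded Qx vx Qy lt.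
case: (boolP (P x')) => [Px'|nPx']; last first.
  by exists x; split=> //; right; exists x'.
apply: (IH x' (tight G h x |: V)) => //.
  have xV : tight G h x \notin V.
    by apply/negP => /(bV x vx); rewrite ltxx.
  have : (#|tight G h x |: V| <= #|{set 'I_q}|)%N by apply: max_card.
  rewrite cardsU1 xV => leU; move: leV; rewrite !ltnS => leV.
  by apply: leq_trans leV; rewrite ltn_sub2l.
move=> z vz; rewrite in_setU1 => /orP[/eqP|zV].
  by move=> E; rewrite (vertex_uniq vz E).
by apply: lt_trans ltx'; apply: bV.
Qed.

End Polyhedra.

(** * Splitting a point of a cone along faces *)

Section ConeSplit.
Variables (F : realFieldType) (n m : nat) (N : 'M[F]_(n, m)).
Implicit Types x p e : 'rV[F]_n.

Definition cone x := forall i, 0 <= (x *m N) 0 i.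
(** For [x] in the cone, this is the dimension of the smallest face containing [x]. *)
Definition fdim x : nat := \rank (ann N (tight N 0 x)).

(** Walk along edges of the polytope of all [x] with [x] and [e - x] in the cone, from [0] towards
    [e], and stop at the last vertex [x] before the face dimension exceeds [k]. The edge leaving [x]
    then forces the face of [e - x] to be small. *)
Lemma cone_split e (k r : nat) :
  (forall w : 'rV_n, w *m N = 0 -> w = 0) ->
  cone e -> (fdim e <= r)%N -> (k <= r)%N ->
  exists p, [/\ cone p, cone (e - p), (fdim p <= k)%N & (fdim (e - p) <= r - k)%N].
Proof.
move=> inj Ce er kr.
(* [polyhedron G h] is this polytope, and [f] sums the entries of [x *m N]; on the polytope its
   maximum is attained only at [e]. *)
pose G : 'M[F]_(n, m + m) := row_mx N (- N).
pose h : 'rV[F]_(m + m) := row_mx 0 (- (e *m N)).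
pose f : 'cV[F]_n := N *m const_mx 1.
have fE x : (x *m f) 0 0 = \sum_i (x *m N) 0 i.
  by rewrite mulmxA [LHS]mxE; apply: eq_bigr => i _; rewrite [const_mx _ _ _]mxE mulr1.
have GL x i : (x *m G) 0 (lshift m i) = (x *m N) 0 i.
  by rewrite mul_mx_row row_mxEl.
have GR x i : (x *m G) 0 (rshift m i) = - (x *m N) 0 i.
  by rewrite mul_mx_row row_mxEr mulmxN [LHS]mxE.
have hL i : h 0 (lshift m i) = 0 by rewrite row_mxEl [LHS]mxE.
have hR i : h 0 (rshift m i) = - (e *m N) 0 i by rewrite row_mxEr [LHS]mxE.
have subE x i : ((e - x) *m N) 0 i = (e *m N) 0 i - (x *m N) 0 i.
  by rewrite mulmxBl [LHS]mxE [X in _ + X]mxE.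
have polyE x : polyhedron G h x <-> cone x /\ cone (e - x).
  split=> [Q|[C1 C2] j].
    split=> i; first by have := Q (lshift m i); rewrite GL hL.
    by have := Q (rshift m i); rewrite GR hR subE; lra.
  rewrite -(splitK j); case: (split j) => i /=; rewrite ?GL ?GR ?hL ?hR //.
  by have := C2 i; rewrite subE; lra.
have tL x i : (lshift m i \in tight G h x) = (i \in tight N 0 x).
  by rewrite in_tight in_tight0 GL hL.
have tR x i : (rshift m i \in tight G h x) = (i \in tight N 0 (e - x)).
  by rewrite in_tight in_tight0 GR hR subE eqr_opp subr_eq0 eq_sym.
have cone0 : cone 0 by move=> i; rewrite mul0mx mxE.
have fdim0 : fdim 0 = 0%N.
  apply/eqP; rewrite mxrank_eq0; apply/rowV0P => v /annP hv; apply: inj.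
  by apply/rowP => j; rewrite hv ?[RHS]mxE // in_tight0 mul0mx mxE.
have [||||| x [Qx Px alt]] := @edge_path F n (m + m) G h f (fun x => fdim x <= k)%N 0 e.
- move=> w wG; rewrite fE big1 // => i _; apply/eqP; rewrite eq_le.
  by have := wG (lshift m i); have := wG (rshift m i); rewrite GL GR oppr_ge0 => -> ->.
- by apply/polyE; rewrite subr0.
- apply/eqP/rowV0P => v /annP hv; apply: inj; apply/rowP => i.
  by rewrite -GL hv ?mxE // tL in_tight0 mul0mx mxE.
- by rewrite fdim0.
- by apply/polyE; rewrite subrr.
have /polyE[Cx Cex] := Qx.
exists x; split=> //; case: alt => [le|[x' [Qx' nPx' rk]]].
  suff -> : e - x = 0 by rewrite fdim0.
  apply: inj; apply/rowP => i; rewrite [RHS]mxE.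
  move: le; rewrite !fE -subr_le0 -sumrB => le.
  have /psumr_eq0P : \sum_i ((e - x) *m N) 0 i = 0.
    apply/eqP; rewrite eq_le sumr_ge0 // andbT.
    by apply: le_trans le; apply: ler_sum => j _; rewrite subE.
  by apply.
(* Let [J1] and [J2] be the constraints on [x] and on [e - x] that are tight along the whole edge.
   The spaces they annihilate meet in dimension at most 1 and have a sum of dimension at most [r].
   The first contains the face of [x'], of dimension above [k], and the second that of [e - x]; the
   dimension formula concludes. *)
set J := _ :&: _ in rk.
pose J1 := [set i | lshift m i \in J]; pose J2 := [set i | rshift m i \in J].
have cap : (\rank (ann N J1 :&: ann N J2) <= 1)%N.
  apply: leq_trans rk; apply: mxrankS; apply/rV_subP => v.
  rewrite sub_capmx => /andP[/annP h1 /annP h2]; apply/annP => j.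
  rewrite -(splitK j); case: (split j) => i /= ij; rewrite ?GL ?GR.
    by apply: h1; rewrite inE.
  by rewrite h2 ?oppr0 // inE.
have sub_e i y : cone y -> cone (e - y) -> i \in tight N 0 e ->
    (i \in tight N 0 y) && (i \in tight N 0 (e - y)).
  move=> /(_ i) C1 /(_ i); rewrite !in_tight0 subE => C2 /eqP ei.
  by rewrite ei in C2 *; rewrite sub0r oppr_eq0 andbb eq_le C1 andbT; lra.
have /polyE[Cx' Cex'] := Qx'.
have add : (\rank (ann N J1 + ann N J2)%MS <= r)%N.
  apply: leq_trans er; apply: mxrankS; rewrite addsmx_sub.
  apply/andP; split; apply: ann_subset; apply/subsetP => i ie;
    rewrite inE in_setI ?tL ?tR.
    by have /andP[-> _] := sub_e i x Cx Cex ie; have /andP[-> _] := sub_e i x' Cx' Cex' ie.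
  by have /andP[_ ->] := sub_e i x Cx Cex ie; have /andP[_ ->] := sub_e i x' Cx' Cex' ie.
have d1 : (k < \rank (ann N J1))%N.
  apply: leq_trans (_ : fdim x' <= _)%N; first by rewrite ltnNge.
  by apply: mxrankS; apply: ann_subset; apply/subsetP => i; rewrite inE in_setI !tL => /andP[].
have d2 : (fdim (e - x) <= \rank (ann N J2))%N.
  by apply: mxrankS; apply: ann_subset; apply/subsetP => i; rewrite inE in_setI !tR => /andP[].
have := mxrank_sum_cap (ann N J1) (ann N J2).
move: cap add d1 d2; rewrite /fdim.
move: (\rank _) (\rank _) (\rank _) (\rank _) (\rank _) => c1 c2 c3 c4 c5; lia.
Qed.

End ConeSplit.

(** * The polar of a planar set with bounded minors *)

Section PolarArea.
Variables (I : finType) (a b : I -> rat) (e1 e2 : I).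
Hypotheses (ae1 : a e1 = 1) (be1 : b e1 = 0) (ae2 : a e2 = 0) (be2 : b e2 = 1).
Hypothesis sym : forall i, exists j, a j = - a i /\ b j = - b i.
Hypothesis det_le1 : forall i j, a i * b j - a j * b i <= 1.

Let a_le1 i : a i <= 1.
Proof. by have := det_le1 i e2; rewrite ae2 be2; lra. Qed.
Let b_le1 i : b i <= 1.
Proof. by have := det_le1 e1 i; rewrite ae1 be1; lra. Qed.
Let a_geN1 i : -1 <= a i.
Proof. by have [j [aj bj]] := sym i; have := a_le1 j; lra. Qed.

Let slope i x := (1 - a i * x) / b i.
Let act x := [arg min_(i < e2 | 0 < b i) slope i x]%O.
(** Over [-1, 1] the graph of [psi] is the upper boundary of the polar of the points [(a i, b i)].
    By symmetry the lower boundary is [- psi (- x)]. *)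
Definition psi (x : rat) : rat := slope (act x) x.

Let b_e2 : 0 < b e2. Proof. by rewrite be2. Qed.

Lemma psi_act x : exists2 i, 0 < b i & a i * x + b i * psi x = 1.
Proof.
have bpos : 0 < b (act x) by rewrite /act; case: arg_minP.
by exists (act x); rewrite // /psi /slope; field; rewrite gt_eqF.
Qed.

Lemma psi_le x i : 0 < b i -> a i * x + b i * psi x <= 1.
Proof.
move=> bi; have : psi x <= slope i x.
  by rewrite /psi /act; case: arg_minP => // j bj /(_ i bi).
by rewrite ler_pdivlMr //; lra.
Qed.

Lemma psi_ge x y : (forall i, 0 < b i -> a i * x + b i * y <= 1) -> y <= psi x.
Proof.
move=> H; have [i bi E] := psi_act x; have := H i bi; rewrite -E.
by rewrite lerD2l ler_pM2l.
Qed.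

Lemma psi_le1 x : psi x <= 1.
Proof. by have := psi_le x b_e2; rewrite ae2 be2; lra. Qed.

Lemma ax_le1 i x : -1 <= x <= 1 -> a i * x <= 1.
Proof. by have := a_le1 i; have := a_geN1 i; nra. Qed.

Lemma psi_ge0 x : -1 <= x <= 1 -> 0 <= psi x.
Proof. by move=> x1; apply: psi_ge => i _; rewrite mulr0 addr0 ax_le1. Qed.

Lemma psi0 : psi 0 = 1.
Proof.
apply/eqP; rewrite eq_le psi_le1 psi_ge // => i _.
by rewrite mulr0 add0r mulr1.
Qed.

(** The bound on the minors says that a quarter turn of the point set lies in its own polar. *)
Lemma psi_rot i : a i <= psi (- b i).
Proof. by apply: psi_ge => j _; have := det_le1 i j; lra. Qed.

Lemma psi_polar x y i : -1 <= x <= 1 -> - psi (- x) <= y <= psi x ->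
  a i * x + b i * y <= 1.
Proof.
move=> x1 /andP[y1 y2]; case: (ltgtP (b i) 0) => bi; last first.
- by rewrite bi mul0r addr0 ax_le1.
- by apply: le_trans (psi_le x bi); rewrite lerD2l ler_pM2l.
have [j [aj bj]] := sym i; have bj0 : 0 < b j by lra.
by have := psi_le (- x) bj0; rewrite aj bj; nra.
Qed.

Lemma psi_concave x x' y y' t : 0 <= t <= 1 -> y <= psi x -> y' <= psi x' ->
  (1 - t) * y + t * y' <= psi ((1 - t) * x + t * x').
Proof.
move=> /andP[t0 t1] yx yx'; apply: psi_ge => i bi.
have p1 := psi_le x bi; have p2 := psi_le x' bi.
have q1 : a i * x + b i * y <= 1 by nra.
have q2 : a i * x' + b i * y' <= 1 by nra.
by nra.
Qed.

Section Grid.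
Variable S : nat.
Hypothesis S_gt0 : (0 < S)%N.
Hypothesis S_b : forall i, exists z : int, S%:R * b i = z%:~R.
Hypothesis S_kink : forall i j, exists z : int,
  S%:R * ((b j - b i) / (a i * b j - a j * b i)) = z%:~R.

Let s0 : 0 < S%:R :> rat. Proof. by rewrite ltr0n. Qed.
Let x_ k : rat := k%:R / S%:R.

(** By [S_kink] two bounding lines cross only over multiples of [1 / S]. An index active at the
    midpoint of a grid cell therefore stays active up to both ends: [psi] is affine on the cell. *)
Lemma common_active j : exists i, [/\ 0 < b i,
  a i * x_ j + b i * psi (x_ j) = 1 & a i * x_ j.+1 + b i * psi (x_ j.+1) = 1].
Proof.
pose xm : rat := (j%:R + 2%:R^-1) / S%:R.
have [i bi Em] := psi_act xm; exists i.
suff H k : (k == j) || (k == j.+1) -> a i * x_ k + b i * psi (x_ k) = 1.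
  by split=> //; apply: H; rewrite eqxx ?orbT.
move=> kj; apply/eqP; rewrite eq_le psi_le //= leNgt; apply/negP => lt.
have [l bl El] := psi_act (x_ k).
have ml := psi_le xm bl.
have [z zE] := S_kink i l.
set D := a i * b l - a l * b i in zE.
(* Up to the positive factor [b i * b l], the affine function [(b i - b l) + x * D] is
   [slope l x - slope i x]. It changes sign between [x_ k] and [xm], but its zero is the grid point
   [z / S]. *)
have gx : (b i - b l) + x_ k * D < 0 by rewrite /D; nra.
have gm : 0 <= (b i - b l) + xm * D by rewrite /D; nra.
have D0 : D != 0 by apply/eqP => D0; rewrite D0 in gx gm; lra.
have E : b i - b l = - (z%:~R / S%:R) * D by rewrite -zE; field; rewrite D0 gt_eqF.
have kx : (k%:R - z%:~R) * D < 0.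
  have -> : (k%:R - z%:~R) * D = S%:R * ((b i - b l) + x_ k * D).
    by rewrite E /x_; field; rewrite gt_eqF.
  by rewrite pmulr_rlt0.
have km : 0 <= (j%:R + 2%:R^-1 - z%:~R) * D.
  have -> : (j%:R + 2%:R^-1 - z%:~R) * D = S%:R * ((b i - b l) + xm * D).
    by rewrite E /xm; field; rewrite gt_eqF.
  by rewrite pmulr_rge0.
have zn (w : nat) : (w%:R : rat) = (w%:Z)%:~R by [].
case: (ltgtP D 0) => D1; last by rewrite D1 eqxx in D0.
  have h1 : z%:~R < (k%:Z)%:~R :> rat by rewrite -zn; nra.
  have h2 : (j%:Z)%:~R < z%:~R :> rat by rewrite -zn; nra.
  rewrite ltr_int in h1; rewrite ltr_int in h2.
  by move: kj h1 h2; clear; lia.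
have h1 : (k%:Z)%:~R < z%:~R :> rat by rewrite -zn; nra.
have h2 : z%:~R < (j.+1%:Z)%:~R :> rat by rewrite -zn -addn1 natrD; nra.
rewrite ltr_int in h1; rewrite ltr_int in h2.
by move: kj h1 h2; clear; lia.
Qed.

Let half (k : nat) := psi (- x_ k) + psi (- x_ k.+1).

(** By [psi_rot] the points [(- b i, a i)] and [(- b i', a i')] lie under the concave graph of
    [psi], hence so does their chord; the left side is the trapezoid sum of the chord. *)
Lemma left_trapezoid i i' (n n' : nat) : (n' <= n)%N ->
  S%:R * b i = n%:R -> S%:R * b i' = n'%:R ->
  S%:R * ((a i + a i') * (b i - b i')) <= \sum_(n' <= k < n) half k.
Proof.
move=> le bn bn'.
(* Reversing the second summand pairs each abscissa with its mirror image in the interval, where the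
   two chord values add up to [a i + a i']. *)
have -> : \sum_(n' <= k < n) half k =
   \sum_(n' <= k < n) (psi (- x_ k) + psi (- x_ (n + n' - k))).
  rewrite big_split /= [X in _ + X]big_nat_rev -big_split /=.
  apply: eq_big_nat => k /andP[k1 k2]; congr (_ + psi (- x_ _)); lia.
have -> : S%:R * ((a i + a i') * (b i - b i')) = \sum_(n' <= k < n) (a i + a i').
  rewrite sumr_const_nat -[RHS]mulr_natl natrB // -bn -bn'; ring.
apply: ler_sum_nat => k /andP[k1 k2].
have nn : (n' < n)%N by apply: leq_ltn_trans k2.
have nn0 : 0 < n%:R - n'%:R :> rat by rewrite subr_gt0 ltr_nat.
pose t : rat := (k%:R - n'%:R) / (n%:R - n'%:R).
have t01 : 0 <= t <= 1.
  rewrite /t divr_ge0 ?ler_pdivrMr ?mul1r ?lerD2r ?subr_ge0 ?ler_nat ?(ltnW k2) //.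
have bE : b i = n%:R / S%:R by rewrite -bn; field; rewrite gt_eqF.
have bE' : b i' = n'%:R / S%:R by rewrite -bn'; field; rewrite gt_eqF.
have h1 := psi_concave t01 (psi_rot i') (psi_rot i).
have h2 := psi_concave t01 (psi_rot i) (psi_rot i').
have -> : x_ k = (1 - t) * b i' + t * b i.
  rewrite bE bE' /t /x_; field; rewrite !gt_eqF //.
have -> : x_ (n + n' - k) = (1 - t) * b i + t * b i'.
  rewrite /x_ natrB; last by lia.
  by rewrite natrD bE bE' /t; field; rewrite !gt_eqF.
clearbody t; rewrite !opprD -!mulrN; lra.
Qed.

Let pot (v1 v2 w1 w2 : rat) := (1 - v1) * (1 - w1) + v2 + w2 - w1 * w2 + v1 * v2.

(* [pot] is a potential for twice the area swept by the pair of a support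
   vector [v] and a boundary point [w] with [v . w = 1]; the two step
   inequalities come down to [(1 - v1) (1 - v2) >= 0] and
   [(1 - w1) (1 - w2) >= 0]. *)
Lemma pot_right v1 v2 w1 w2 w1' w2' : v1 <= 1 -> 0 < v2 <= 1 -> w1 <= w1' ->
  v1 * w1 + v2 * w2 = 1 -> v1 * w1' + v2 * w2' = 1 ->
  pot v1 v2 w1 w2 - pot v1 v2 w1' w2' <= (w2 + w2') * (w1' - w1).
Proof.
move=> v1_1 /andP[v2_0 v2_1] w1w E E'.
have E2 : w2 = (1 - v1 * w1) / v2.
  have -> : 1 - v1 * w1 = v2 * w2 by lra.
  by field; rewrite gt_eqF.
have E2' : w2' = (1 - v1 * w1') / v2.
  have -> : 1 - v1 * w1' = v2 * w2' by lra.
  by field; rewrite gt_eqF.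
rewrite -subr_ge0 /pot.
suff -> : (w2 + w2') * (w1' - w1) - ((1 - v1) * (1 - w1) + v2 + w2 - w1 * w2 + v1 * v2 -
  ((1 - v1) * (1 - w1') + v2 + w2' - w1' * w2' + v1 * v2)) =
  (w1' - w1) * ((1 - v1) * (1 - v2)) / v2.
  by rewrite divr_ge0 ?(ltW v2_0) // !mulr_ge0 ?subr_ge0.
by rewrite E2 E2'; field; rewrite gt_eqF.
Qed.

Lemma pot_left v1 v2 v1' v2' w1 w2 : w1 <= 1 -> w2 <= 1 ->
  v1 * w1 + v2 * w2 = 1 -> v1' * w1 + v2' * w2 = 1 -> v1 * v2' <= v1' * v2 ->
  pot v1 v2 w1 w2 - pot v1' v2' w1 w2 <= (v1 + v1') * (v2 - v2').
Proof.
move=> w1_1 w2_1 E E' dt.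
set d := v1' * v2 - v1 * v2'.
have d0 : 0 <= d by rewrite subr_ge0.
have Eb : v2 - v2' = w1 * d.
  have -> : v2 - v2' = v2 * (v1' * w1 + v2' * w2) - v2' * (v1 * w1 + v2 * w2)
    by rewrite E E'; ring.
  by rewrite /d; ring.
have Ea : v1' - v1 = w2 * d.
  have -> : v1' - v1 = v1' * (v1 * w1 + v2 * w2) - v1 * (v1' * w1 + v2' * w2)
    by rewrite E E'; ring.
  by rewrite /d; ring.
have pos : 0 <= (1 - w1) * (1 - w2) * d by rewrite !mulr_ge0 ?subr_ge0.
have -> : pot v1 v2 w1 w2 - pot v1' v2' w1 w2 =
   (v1' - v1) * (1 - w1) + (v2 - v2') + (v1 * v2 - v1' * v2') by rewrite /pot; ring.
have -> : (v1 + v1') * (v2 - v2') = d + (v1 * v2 - v1' * v2') by rewrite /d; ring.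
by rewrite lerD2r Ea Eb; lra.
Qed.

Lemma x_in01 k : (k <= S)%N -> 0 <= x_ k <= 1.
Proof. by move=> kS; rewrite /x_ divr_ge0 //= ler_pdivrMr // mul1r ler_nat. Qed.

Lemma nat_b i : 0 <= b i -> exists n : nat, S%:R * b i = n%:R.
Proof.
move=> bi; have [z zE] := S_b i; exists `|z|%N.
rewrite zE pmulrn gez0_abs // -(ler_int rat) -zE mulr_ge0 //.
Qed.

Let chain_bound (s p0 p1 p2 r l h Rt Lt : rat) :
  s * (p0 - p1) <= r -> s * (p1 - p2) <= l -> l <= h -> s * p2 <= Rt + Lt ->
  s * p0 <= r + Rt + (Lt + h).
Proof. lra. Qed.

(** The right side is the trapezoid sum of [psi] over [-1, 1], that is [S] times the area of the
    polar. The boundary is swept from [x = 0] to [x = 1] while the rotated active vectors sweep the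
    left half. Each step lowers [pot] by at most the trapezoids it covers, and the bound accumulates
    by induction from [x = 1] backwards. *)
Lemma polar_area :
  3%:R * S%:R <= \sum_(k < S) (psi (x_ k) + psi (x_ k.+1) + psi (- x_ k) + psi (- x_ k.+1)).
Proof.
have claim t : (t < S)%N -> forall i, 0 < b i ->
  let j := (S.-1 - t)%N in
  a i * x_ j + b i * psi (x_ j) = 1 -> a i * x_ j.+1 + b i * psi (x_ j.+1) = 1 ->
  forall n : nat, S%:R * b i = n%:R ->
  S%:R * pot (a i) (b i) (x_ j) (psi (x_ j)) <=
    \sum_(j <= k < S) (psi (x_ k) + psi (x_ k.+1)) + \sum_(0 <= k < n) half k.
  elim: t => [|t IH] tS i bi j E E' n bn.
    (* Last cell: over [x = 1] the potential equals [(1 + a i) * b i], exactly the trapezoid between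
       [i] and [e1]. *)
    have jS : j.+1 = S by rewrite /j; lia.
    rewrite -jS big_nat1 jS.
    have x1 : x_ S = 1 by rewrite /x_ divff // gt_eqF.
    have := @left_trapezoid i e1 n 0 (leq0n _) bn.
    rewrite be1 mulr0 ae1 => /(_ (erefl _)) HL.
    rewrite jS x1 in E'.
    have bi1 : 0 < b i <= 1 by rewrite bi b_le1.
    have xj1 : x_ j <= 1 by have /andP[] := @x_in01 j ltac:(lia).
    have := pot_right (a_le1 i) bi1 xj1 E E'; rewrite -(ler_pM2l s0).
    have -> : S%:R * ((psi (x_ j) + psi 1) * (1 - x_ j)) = psi (x_ j) + psi 1.
      have -> : 1 - x_ j = S%:R^-1.
        rewrite /x_; have -> : j%:R = S%:R - 1 :> rat by rewrite -jS -natr1 addrK.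
        by field; rewrite gt_eqF.
      by field; rewrite gt_eqF.
    by rewrite x1; move: HL; rewrite /pot; lra.
  set j' := (S.-1 - t)%N in IH; have jj : j' = j.+1 by rewrite /j /j'; lia.
  have [i' [bi' F F']] := common_active j'.
  have [n' bn'] := nat_b (ltW bi').
  have {}IH := IH (ltnW tS) i' bi' F F' n' bn'.
  have bi1 : 0 < b i <= 1 by rewrite bi b_le1.
  have jS : (j.+1 < S)%N by rewrite /j; lia.
  have dx : x_ j.+1 - x_ j = S%:R^-1 by rewrite /x_ -addn1 natrD; field; rewrite gt_eqF.
  have dx0 : 0 < S%:R^-1 :> rat by rewrite invr_gt0.
  have xx : x_ j <= x_ j.+1 by lra.
  have R1 := pot_right (a_le1 i) bi1 xx E E'.
  rewrite -(ler_pM2l s0) dx mulrCA divff ?gt_eqF // mulr1 in R1.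
  rewrite jj in F F' IH.
  have [x0 x1] := andP (@x_in01 j.+1 (ltnW jS)).
  (* Along a concave graph the active normals turn clockwise as [x] increases. *)
  have ori : a i * b i' <= a i' * b i.
    have := psi_le (x_ j) bi'; move: E E' F => E E' F le.
    have h1 : 0 <= a i' * (x_ j.+1 - x_ j) + b i' * (psi (x_ j.+1) - psi (x_ j)) by lra.
    have h2 : b i * (psi (x_ j.+1) - psi (x_ j)) = - a i * (x_ j.+1 - x_ j) by lra.
    rewrite dx in h1 h2.
    have : 0 <= b i * (a i' * S%:R^-1) + b i' * (b i * (psi (x_ j.+1) - psi (x_ j))).
      by have := mulr_ge0 (ltW bi) h1; lra.
    rewrite h2; have -> : b i * (a i' / S%:R) + b i' * (- a i / S%:R) =
        (a i' * b i - a i * b i') / S%:R by ring.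
    by rewrite pmulr_lge0 // subr_ge0.
  have L1 := pot_left x1 (psi_le1 _) E' F ori.
  have nn : (n' <= n)%N.
    rewrite -(ler_nat rat) -bn -bn' ler_pM2l //.
    have m1 : b i * (a i' * x_ j.+1 + b i' * psi (x_ j.+1)) = b i by rewrite F mulr1.
    have m2 : b i' * (a i * x_ j.+1 + b i * psi (x_ j.+1)) = b i' by rewrite E' mulr1.
    by have := ler_wpM2l x0 ori; lra.
  have L2 := left_trapezoid nn bn bn'.
  rewrite -(ler_pM2l s0) in L1.
  rewrite (big_ltn (ltnW jS : j < S)%N).
  rewrite (@big_cat_nat _ _ _ n' 0 n) //=.
  exact: chain_bound R1 L1 L2 IH.
(* Over [x = 0] the boundary point is [(0, 1)] and the active vector has [b i = 1], so [pot] starts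
   at exactly 3. *)
have [i [bi E E']] := common_active 0.
have x00 : x_ 0 = 0 by rewrite /x_ mul0r.
have b1 : b i = 1 by move: E; rewrite x00 psi0; lra.
have := @claim S.-1; rewrite subnn ltn_predL => /(_ S_gt0 i bi E E' S).
rewrite b1 mulr1 => /(_ (erefl _)).
rewrite x00 psi0 !big_mkord -big_split /=.
under eq_bigr do rewrite /half addrA.
by apply: le_trans; rewrite /pot; lra.
Qed.
End Grid.
End PolarArea.

(** * Lattice points in dilates of the polar *)

Lemma common_denominator (I : finType) (x : I -> rat) :
  exists D : nat, (0 < D)%N /\
    forall (k : nat) i, (D %| k)%N -> exists z : int, k%:R * x i = z%:~R.
Proof.
exists (\prod_i `|denq (x i)|)%N; split.
  by rewrite prodn_gt0 // => i; rewrite absz_gt0 denq_neq0.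
move=> k i; rewrite (bigD1 i) //= => /dvdnP[c ->].
exists ((c * \prod_(j | j != i) `|denq (x j)|)%N%:Z * numq (x i)).
rewrite intrM numqE -pmulrn !natrM.
have -> : `|denq (x i)|%:R = (denq (x i))%:~R :> rat.
  by rewrite pmulrn gez0_abs // ltW // denq_gt0.
ring.
Qed.

(** Integrality turns [4 * delta < 3 * kappa] into a gap of order [N ^ 2]. With this [N] it absorbs
    two linear errors: the boundary term [2 * (D * N)] and the enlargement from [N] to [N.+1]. *)
Lemma dilation_count (D N kappa delta c : nat) :
  N = (2 * kappa + 8 * delta + 4)%N -> (0 < D)%N -> (4 * delta < 3 * kappa)%N ->
  (3 * (D * N) ^ 2 <= c + 2 * (D * N))%N ->
  (delta * (2 * D * N.+1) ^ 2 < kappa * c)%N.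
Proof.
move=> NE D0 dk cY.
have h1 : (D * D * (8 * delta * N + 4 * delta + 2 * kappa * N) < D * D * (N * N))%N.
  by rewrite ltn_pmul2l ?muln_gt0 ?D0 // {4}NE; nia.
have h2 : (kappa * (3 * (D * N) ^ 2) <= kappa * (c + 2 * (D * N)))%N
  by rewrite leq_mul2l cY orbT.
have h3 : ((4 * delta).+1 * (D * D * (N * N)) <= 3 * kappa * (D * D * (N * N)))%N
  by rewrite leq_mul2r dk orbT.
have h4 : (2 * kappa * (D * N) <= D * D * (2 * kappa * N))%N by nia.
rewrite -(ltn_add2r (2 * kappa * (D * N))).
have -> : (kappa * c + 2 * kappa * (D * N) = kappa * (c + 2 * (D * N)))%N by ring.
apply: leq_trans h2.
have -> : (kappa * (3 * (D * N) ^ 2) = 3 * kappa * (D * D * (N * N)))%N by ring.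
apply: leq_trans h3.
have -> : (delta * (2 * D * N.+1) ^ 2 =
    4 * delta * (D * D * (N * N)) + D * D * (8 * delta * N + 4 * delta))%N by ring.
have -> : ((4 * delta).+1 * (D * D * (N * N)) =
    4 * delta * (D * D * (N * N)) + D * D * (N * N))%N by ring.
rewrite -addnA ltn_add2l; apply: leq_ltn_trans h1.
by rewrite [X in (_ <= X)%N]mulnDr leq_add2l.
Qed.

Section PolarLatticePoints.
Variables (I : finType) (a b : I -> rat) (e1 e2 : I).
Hypotheses (ae1 : a e1 = 1) (be1 : b e1 = 0) (ae2 : a e2 = 0) (be2 : b e2 = 1).
Hypothesis sym : forall i, exists j, a j = - a i /\ b j = - b i.
Hypothesis det_le1 : forall i j, a i * b j - a j * b i <= 1.

(** [Y] enumerates integer points of the [S]-fold polar column by column. Their differences lie in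
    the [2 * S]-fold polar, and [T] slightly exceeds [2 * S] to make the inequality strict. *)
Lemma polar_lattice_points (q0 kappa delta : nat) :
  (0 < q0)%N -> (4 * delta < 3 * kappa)%N ->
  exists (T : nat) (Y : finType) (y : Y -> int * int),
  [/\ (0 < T)%N /\ (q0 %| T)%N, injective y,
      forall s t i, a i * ((y s).1 - (y t).1)%:~R + b i * ((y s).2 - (y t).2)%:~R < T%:R
    & (delta * T ^ 2 < kappa * #|Y|)%N].
Proof.
move=> q0_gt0 dk.
have [D1 [D1_gt0 D1P]] := common_denominator b.
have [D2 [D2_gt0 D2P]] := common_denominator
  (fun ij : I * I => (b ij.2 - b ij.1) / (a ij.1 * b ij.2 - a ij.2 * b ij.1)).
pose D := (q0 * D1 * D2)%N; pose N := (2 * kappa + 8 * delta + 4)%N.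
pose S := (D * N)%N; pose T := (2 * D * N.+1)%N.
have D_gt0 : (0 < D)%N by rewrite !muln_gt0 q0_gt0 D1_gt0.
have S_gt0 : (0 < S)%N by rewrite muln_gt0 D_gt0 /N; lia.
have s0 : 0 < S%:R :> rat by rewrite ltr0n.
have Sb i : exists z : int, S%:R * b i = z%:~R.
  by apply: D1P; rewrite /S /D -!mulnA; apply/dvdn_mull/dvdn_mulr.
have Sk i j : exists z : int,
    S%:R * ((b j - b i) / (a i * b j - a j * b i)) = z%:~R.
  by apply: (D2P S (i, j)); rewrite /S /D -!mulnA; apply/dvdn_mull/dvdn_mull/dvdn_mulr.
have := polar_area ae1 be1 ae2 be2 det_le1 S_gt0 Sb Sk.
set ps := psi a b e2 => area.
(* The columns have abscissas [- S] to [S - 1]. Leaving out [S] makes their total length match the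
   sum in [area]; rounding loses at most 1 in each of the [2 * S] columns. *)
pose col (p : bool * 'I_S) : int := if p.1 then - p.2.+1%:Z else p.2%:Z.
pose X p : rat := (col p)%:~R / S%:R.
have X1 p : -1 <= X p <= 1.
  rewrite /X ler_pdivlMr // ler_pdivrMr // mulN1r mul1r.
  have -> : S%:R = S%:Z%:~R :> rat by [].
  by rewrite -mulrNz !ler_int /col; case: p => -[] k /=; have := ltn_ord k; lia.
have X1N p : -1 <= - X p <= 1 by have := X1 p; lra.
pose fl x := Num.truncn (S%:R * ps x).
have flP x : -1 <= x <= 1 -> (fl x)%:R <= S%:R * ps x < (fl x).+1%:R.
  move=> x1; apply: truncn_itv; apply: mulr_ge0; first exact: ltW.
  exact: (psi_ge0 ae2 be2 sym det_le1).
pose H p := (fl (X p) + fl (- X p)).+1.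
pose Y : finType := {p : bool * 'I_S & 'I_(H p)}.
pose y (u : Y) : int * int :=
  (col (tag u), (tagged u : nat)%:Z - (fl (- X (tag u)))%:Z).
have col_inj : injective col.
  move=> [c k] [c' k']; rewrite /col /=; case: c; case: c' => //= E; try by exfalso; lia.
    by congr (_, _); apply/val_inj => /=; lia.
  by congr (_, _); apply/val_inj => /=; lia.
exists T, Y, y; split.
- split; first by rewrite /T -mulnA muln_gt0 /= muln_gt0 D_gt0.
  by rewrite /T /D -!mulnA; apply/dvdn_mull/dvdn_mulr.
- move=> [p k] [p' k'] [/= /col_inj E]; case: _ / E k' => k' E.
  by congr (Tagged _ _); apply/val_inj => /=; lia.
- have polar u i : a i * (y u).1%:~R + b i * (y u).2%:~R <= S%:R.
    case: u => p k; rewrite /y /=.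
    have k2 : -  ps (- X p) <= ((k : nat)%:Z - (fl (- X p))%:Z)%:~R / S%:R <= ps (X p).
      rewrite ler_pdivlMr // ler_pdivrMr // intrB -!pmulrn.
      have /andP[f1 _] := flP _ (X1 p); have /andP[g1 _] := flP _ (X1N p).
      have : (k : nat)%:R <= (fl (X p) + fl (- X p))%:R :> rat.
        by rewrite ler_nat -ltnS ltn_ord.
      rewrite natrD; have : 0 <= (k : nat)%:R :> rat by [].
      by rewrite -/ps; lra.
    have := psi_polar ae2 be2 sym det_le1 i (X1 p) k2.
    rewrite /X -(ler_pM2l s0) mulr1; congr (_ <= _).
    by field; rewrite gt_eqF.
  move=> s t i; have [j [aj bj]] := sym i.
  have h1 := polar s i; have := polar t j; rewrite aj bj => h2.
  have : S%:R + S%:R < T%:R :> rat.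
    by rewrite -natrD ltr_nat /S /T; have := D_gt0; nia.
  case: (y s) (y t) h1 h2 => s1 s2 [t1 t2] /=; rewrite !intrB.
  clear; lra.
have cardY : 3%:R * S%:R ^+ 2 <= #|Y|%:R + 2%:R * S%:R :> rat.
  have cH p : S%:R * (ps (X p) + ps (- X p)) <= (H p)%:R + 1.
    have /andP[_ u1] := flP _ (X1 p); have /andP[_ u2] := flP _ (X1N p).
    rewrite -natr1 in u1; rewrite -natr1 in u2.
    rewrite mulrDr /H -natr1 natrD; apply: le_trans (lerD (ltW u1) (ltW u2)) _.
    by rewrite addrACA addrA.
  have -> : #|Y| = (\sum_p H p)%N.
    rewrite card_tagged sumnE big_map big_enum /=.
    by apply: eq_bigr => p _; rewrite card_ord.
  have : \sum_p S%:R * (ps (X p) + ps (- X p)) <= \sum_p ((H p)%:R + 1).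
    by apply: ler_sum => p _; apply: cH.
  rewrite big_split /= -natr_sum sumr_const card_prod card_bool card_ord (natrM _ 2 S).
  apply: le_trans; rewrite -mulr_sumr expr2 mulrCA ler_pM2l //.
  apply: le_trans area _.
  rewrite -(pair_big xpredT xpredT (fun c k => ps (X (c, k)) + ps (- X (c, k)))) /=.
  rewrite big_bool /= -big_split /=; apply: ler_sum => k _.
  by rewrite /X /col /= mulrNz mulNr opprK -!pmulrn; lra.
have : (3 * S ^ 2 <= #|Y| + 2 * S)%N.
  by rewrite -(ler_nat rat) natrD !(natrM _ _ S) natrM natrX.
rewrite /S /T => cY.
by apply: (dilation_count _ D_gt0 dk cY).
Qed.
End PolarLatticePoints.

(** * Pigeonhole modulo a lattice *)

Lemma absz_det_unitmx n (L : 'M[int]_n) : L \in unitmx -> `|\det L|%N = 1%N.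
Proof. by rewrite unitmxE unfold_in /= => /orP[]/eqP->. Qed.

(** The lattice generated by [B] has index [|det B|]. By Smith normal form a class is determined by
    the residues of [invmx L *m g x] modulo the diagonal entries. *)
Lemma lattice_pigeonhole n (B : 'M[int]_n) (X : finType) (g : X -> 'cV[int]_n) :
  \det B != 0 -> (`|\det B| < #|X|)%N ->
  exists x x' u, x != x' /\ g x - g x' = B *m u.
Proof.
have [L Lu [R Ru [d _ BE]]] := int_Smith_normal_form B.
set Dm := (X in L *m X *m R) in BE.
have DmE : Dm = diag_mx (\row_i d`_i) by apply/matrixP => i j; rewrite !mxE.
have detE : `|\det B|%N = (\prod_(i < n) `|(d`_i)%R|)%N.
  rewrite BE !det_mulmx !abszM !(absz_det_unitmx Lu) (absz_det_unitmx Ru) muln1 mul1n DmE det_diag.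
  rewrite (big_morph absz abszM (erefl _)).
  by apply: eq_bigr => i _; rewrite mxE.
move=> det0; rewrite detE => ltX.
have d0 (i : 'I_n) : d`_i != 0.
  move: det0; rewrite -absz_eq0 detE -lt0n => /gt0_prodn/(_ i isT).
  by rewrite absz_gt0.
pose K := (\sum_(i < n) `|(d`_i)%R|)%N.
pose h x := invmx L *m g x.
pose rr x : {ffun 'I_n -> 'I_K.+1} := [ffun i => inord `|(h x i ord0 %% d`_i)%Z|].
have rrE x (i : 'I_n) : (rr x i : nat) = `|(h x i ord0 %% d`_i)%Z|%N /\ (rr x i < `|(d`_i)%R|)%N.
  have lt : (`|(h x i ord0 %% d`_i)%Z| < `|(d`_i)%R|)%N.
    by have := ltz_mod (h x i ord0) (d0 i); have := modz_ge0 (h x i ord0) (d0 i); lia.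
  rewrite ffunE inordK // ltnS (leq_trans (ltnW lt)) // /K (bigD1 i) //=.
  by rewrite leq_addr.
have /injectivePn[x [x' xx' E]] : ~~ injectiveb rr.
  apply: contraL ltX => /injectiveP inj; rewrite -leqNgt.
  rewrite -(card_codom inj).
  pose Fm (i : 'I_n) := [pred j : 'I_K.+1 | (j < `|(d`_i)%R|)%N].
  have : (#|codom rr| <= #|(family Fm : simpl_pred {ffun 'I_n -> 'I_K.+1})|)%N.
    apply: subset_leq_card; apply/subsetP => f /codomP[z ->].
    by apply/familyP => i; have [_] := rrE z i.
  move/leq_trans; apply; rewrite card_family foldrE big_map big_enum /=.
  apply: leq_prod => i _.
  have dK : (`|(d`_i)%R| <= K.+1)%N by rewrite /K (bigD1 i) //= leqW // leq_addr.
  by rewrite -sum1_card (big_ord_narrow dK) sum1_card card_ord.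
pose w : 'cV[int]_n := \col_i ((h x i ord0 - h x' i ord0) %/ d`_i)%Z.
exists x, x', (invmx R *m w); split=> //.
rewrite BE -!mulmxA [R *m _]mulmxA mulmxV // mul1mx.
rewrite -[LHS]mul1mx -(mulmxV Lu) -mulmxA; congr (_ *m _).
rewrite mulmxBr DmE; apply/colP => i.
rewrite -/(h x) -/(h x') mul_diag_mx [LHS]mxE [X in _ + X = _]mxE
  [RHS]mxE [X in _ = X * _]mxE [X in _ = _ * X]mxE.
rewrite mulrC divzK // -eqz_mod_dvd; apply/eqP.
have [e1 _] := rrE x i; have [e2 _] := rrE x' i.
have := modz_ge0 (h x i ord0) (d0 i); have := modz_ge0 (h x' i ord0) (d0 i).
move: e1 e2; rewrite E => ->.
by move: (modz (h x i ord0) _) (modz (h x' i ord0) _) => p q pq p0 q0; lia.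
Qed.

Lemma intmxM (R : realFieldType) m n p (M : 'M[int]_(m, n)) (M' : 'M[int]_(n, p)) :
  intmx R (M *m M') = intmx R M *m intmx R M'.
Proof. exact: (@map_mxM _ _ (intmul 1)). Qed.

Lemma intmxB (R : realFieldType) m n (M M' : 'M[int]_(m, n)) :
  intmx R (M - M') = intmx R M - intmx R M'.
Proof. exact: (@map_mxB _ _ (intmul 1)). Qed.

Lemma intmxD (R : realFieldType) m n (M M' : 'M[int]_(m, n)) :
  intmx R (M + M') = intmx R M + intmx R M'.
Proof. exact: (@map_mxD _ _ (intmul 1)). Qed.

Lemma det_intmx (R : realFieldType) n (M : 'M[int]_n) :
  \det (intmx R M) = (\det M)%:~R.
Proof. exact: (@det_map_mx _ _ (intmul 1)). Qed.

(** The matrices over which [Delta_alpha] takes its maximum. *)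
Definition alpha_mx m n (alpha : 'cV[int]_n) (A : 'M[int]_(m, n)) (f : 'I_n -> 'I_m) :
  'M[int]_n :=
  \matrix_(i, j) (if nat_of_ord i == 0%N then alpha j ord0 else A (f i) j).

(* The set [0, p] + {x : |A x| < 1} contains no nonzero integer vector. *)
Definition lattice_free m n (A : 'M[int]_(m, n)) (p : 'cV[rat]_n) :=
  forall (u : 'cV[int]_n) (t : rat), u != 0 -> 0 <= t <= 1 ->
  ~ (forall i, `|(intmx rat A *m intmx rat u) i 0 - t * (intmx rat A *m p) i 0| < 1).

Section Pigeonhole.
Variables (m n0 k : nat) (A : 'M[int]_(m, n0 + k)) (alpha : 'cV[int]_(n0 + k)).
Variables (p : 'cV[rat]_(n0 + k)) (f : 'I_(n0 + k) -> 'I_m).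
Let B := alpha_mx alpha A f.
Let AQ := intmx rat A.
Let BQ := intmx rat B.
Let ap := dot alpha p.

Lemma alpha_mx_mul (i : 'I_(n0 + k)) (x : 'cV[rat]_(n0 + k)) :
  (BQ *m x) i 0 = if nat_of_ord i == 0%N then dot alpha x else (AQ *m x) (f i) 0.
Proof.
by rewrite [LHS]mxE; case: ifP => i0; rewrite ?mxE /dot;
  apply: eq_bigr => j _; rewrite !mxE i0.
Qed.

Hypotheses (n0_gt0 : (0 < n0)%N) (detB : \det B != 0) (ap0 : ap != 0).
Hypothesis tight_p : forall i : 'I_(n0 + k), (0 < i < n0)%N -> (AQ *m p) (f i) 0 = 0.

(** In the coordinates given by [B], the points [y / T] are translated by [s / |ap|] times [p], for
    [s] from 0 to [sigma]. Two of these points are congruent modulo the lattice, and their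
    difference [u] is close to some [t *: p]. *)
Lemma pigeonhole_bound (Y : finType) (y : Y -> 'cV[int]_k) (T sigma : nat) :
  injective y -> (0 < T)%N -> sigma%:R <= `|ap| ->
  (forall l, exists z : int, T%:R * ((AQ *m p) (f (rshift n0 l)) 0 / `|ap|) = z%:~R) ->
  (forall s t i, `|(rsubmx (AQ *m invmx BQ) *m intmx rat (y s - y t)) i 0| < T%:R) ->
  (T ^ k * `|\det B| < sigma.+1 * #|Y|)%N ->
  ~ lattice_free A p.
Proof.
move=> y_inj T0 sig hz Yd count free.
have T0' : 0 < T%:R :> rat by rewrite ltr0n.
have nap0 : 0 < `|ap| by rewrite normr_gt0.
have BQu : BQ \in unitmx by rewrite unitmxE det_intmx unitfE intr_eq0.
pose h : 'cV[int]_k := \col_l Num.floor (T%:R * ((AQ *m p) (f (rshift n0 l)) 0 / `|ap|)).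
have hE l : (h l 0)%:~R = T%:R * ((AQ *m p) (f (rshift n0 l)) 0 / `|ap|).
  by rewrite mxE; have [z ->] := hz l; rewrite intrKfloor.
pose eps : int := if 0 < ap then 1 else -1.
have epsE : eps%:~R * `|ap| = ap.
  rewrite /eps; case: ltP => [pos|neg]; first by rewrite mul1r gtr0_norm.
  by rewrite ler0_norm // mulrNz mulNr mul1r opprK.
have eps0 : eps != 0 by rewrite /eps; case: ifP.
pose top (s : nat) : 'cV[int]_n0 := \col_i (if nat_of_ord i == 0%N then eps * s%:Z else 0).
pose G (x : 'I_sigma.+1 * Y) : 'cV[int]_(n0 + k) :=
  col_mx (top x.1) ((x.1 : nat)%:Z *: h + y x.2).
(* Scaling the last [k] coordinates by [T] clears denominators and multiplies the index by
   [T ^ k]. *)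
pose BT : 'M[int]_(n0 + k) := col_mx (usubmx B) (T%:Z *: dsubmx B).
have detBT : \det BT = T%:Z ^+ k * \det B.
  have -> : BT = block_mx 1%:M 0 0 (T%:Z%:M) *m B.
    by rewrite -[X in _ *m X](vsubmxK B) mul_block_col mul1mx !mul0mx addr0 add0r mul_scalar_mx.
  by rewrite det_mulmx det_lblock det1 mul1r det_scalar.
have absBT : `|\det BT|%N = (T ^ k * `|\det B|)%N.
  by rewrite detBT abszM abszX.
have BT0 : \det BT != 0 by rewrite -absz_gt0 absBT muln_gt0 expn_gt0 T0 absz_gt0.
have cX : (`|\det BT| < #|{: 'I_sigma.+1 * Y}|)%N by rewrite absBT card_prod card_ord.
have G_inj : injective G.
  move=> [s a] [s' a'] /eq_col_mx[/= /colP/(_ (Ordinal n0_gt0))].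
  rewrite !mxE /= => /(mulfI eps0)[ss'] /eqP.
  have -> : s = s' by apply: val_inj.
  by rewrite (inj_eq (addrI _)) => /eqP/y_inj->.
have [x [x' [u [xx' Gu]]]] := lattice_pigeonhole G BT0 cX.
wlog le : x x' u xx' Gu / (x'.1 <= x.1)%N.
  move=> H; case: (leqP x'.1 x.1) => le; first exact: (H x x' u).
  apply: (H x' x (- u)); rewrite 1?eq_sym //; last exact: ltnW.
  by rewrite mulmxN -Gu opprB.
have u0 : u != 0.
  apply: contraNneq xx' => u0; move: Gu; rewrite u0 mulmx0 => /eqP.
  by rewrite subr_eq0 => /eqP/G_inj->.
pose ds : rat := (x.1 : nat)%:R - (x'.1 : nat)%:R.
pose t := ds / `|ap|.
have ds0 : 0 <= ds by rewrite subr_ge0 ler_nat.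
have t01 : 0 <= t <= 1.
  rewrite /t divr_ge0 //= ler_pdivrMr // mul1r; apply: le_trans sig.
  apply: le_trans (_ : (x.1 : nat)%:R <= _); first by rewrite gerBl.
  by rewrite ler_nat -ltnS.
apply: (free u t u0 t01) => i.
pose uq := intmx rat u.
have Gq : intmx rat BT *m uq = intmx rat (G x) - intmx rat (G x').
  by rewrite -intmxM -Gu intmxB.
have upper (j : 'I_n0) : (BQ *m uq) (lshift k j) 0 =
    if nat_of_ord j == 0%N then eps%:~R * ds else 0.
  have : (intmx rat BT *m uq) (lshift k j) 0 = (BQ *m uq) (lshift k j) 0.
    rewrite [LHS]mxE [RHS]mxE; apply: eq_bigr => l _; congr (_ * _).
    by rewrite [LHS]mxE [RHS]mxE col_mxEu mxE.
  move=> <-; rewrite Gq [LHS]mxE [X in _ + X]mxE /G.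
  rewrite [X in X - _]mxE [X in _ - X]mxE !col_mxEu /top [X in X%:~R - _]mxE [X in _ - X%:~R]mxE.
  by case: ifP => _; rewrite ?subrr // !intrM -!pmulrn -mulrBr.
have lower (j : 'I_k) : T%:R * (BQ *m uq) (rshift n0 j) 0 =
    ds * (h j 0)%:~R + (intmx rat (y x.2 - y x'.2)) j 0.
  have -> : T%:R * (BQ *m uq) (rshift n0 j) 0 = (intmx rat BT *m uq) (rshift n0 j) 0.
    rewrite [RHS]mxE [X in _ * X]mxE mulr_sumr; apply: eq_bigr => l _.
    rewrite mulrA; congr (_ * _).
    by rewrite [in LHS]mxE [RHS]mxE col_mxEd !mxE intrM -pmulrn.
  rewrite Gq [LHS]mxE [X in _ + X]mxE /G.
  rewrite [X in X - _]mxE [X in _ - X]mxE !col_mxEd [X in X%:~R - _]mxE [X in _ - X%:~R]mxE.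
  rewrite [X in (X + _)%:~R - _]mxE [X in _ - (X + _)%:~R]mxE [X in _ = _ + X]mxE.
  rewrite [X in _ = _ + X%:~R]mxE [X in _ = _ + (_ + X)%:~R]mxE.
  by rewrite intrB !intrD !intrM -!pmulrn /ds; ring.
have low_p (l : 'I_k) : (BQ *m p) (rshift n0 l) 0 = (AQ *m p) (f (rshift n0 l)) 0.
  by rewrite alpha_mx_mul /= addn_eq0 (gtn_eqF n0_gt0).
(* The choice of [t] cancels the [alpha] coordinate, and the next rows of [B] vanish on both [u] and
   [p]. *)
have BV : BQ *m (uq - t *: p) = col_mx 0 (T%:R^-1 *: intmx rat (y x.2 - y x'.2)).
  apply/colP => j; rewrite mulmxBr -scalemxAr [LHS]mxE [X in _ + X]mxE [X in _ - X]mxE.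
  rewrite -(splitK j); case: (split j) => l /=.
    rewrite upper col_mxEu [RHS]mxE alpha_mx_mul /=; case: ifP => l0.
      by rewrite -/ap -epsE /t; field; rewrite gt_eqF.
    by rewrite tight_p ?mulr0 ?subrr //= ltn_ord andbT lt0n l0.
  rewrite col_mxEd [RHS]mxE low_p; apply: (@mulfI _ T%:R); first by rewrite gt_eqF.
  rewrite mulrBr lower hE /t.
  by field; rewrite !gt_eqF.
have -> : (AQ *m uq) i 0 - t * (AQ *m p) i 0 =
   T%:R^-1 * (rsubmx (AQ *m invmx BQ) *m intmx rat (y x.2 - y x'.2)) i 0.
  transitivity ((AQ *m invmx BQ *m (BQ *m (uq - t *: p))) i 0).
    by rewrite -mulmxA (mulKmx BQu) mulmxBr -scalemxAr
      [RHS]mxE [X in _ = _ + X]mxE [X in _ = _ - X]mxE.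
  rewrite BV -{1}(hsubmxK (AQ *m invmx BQ)) mul_row_col mulmx0 add0r -scalemxAr.
  by rewrite [LHS]mxE.
rewrite normrM gtr0_norm ?invr_gt0 // mulrC ltr_pdivrMr // mul1r.
exact: Yd.
Qed.
End Pigeonhole.

(** * Maximal minors *)

(** Basis extension from [alpha]. Together with [alpha] the rows in [J] span more than [r]
    dimensions, so they supply the first [r] further rows; full column rank supplies the rest. *)
Lemma select_rows m n (A : 'M[int]_(m, n)) (alpha : 'cV[int]_n) (J : {set 'I_m}) (r : nat) :
  (r < n)%N -> \rank (intmx rat A) = n ->
  (r <= \rank (colmask (intmx rat A)^T J)^T)%N ->
  ~~ ((intmx rat alpha)^T <= (colmask (intmx rat A)^T J)^T)%MS ->
  exists f : 'I_n -> 'I_m, \det (alpha_mx alpha A f) != 0 /\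
    forall i : 'I_n, (0 < i <= r)%N -> f i \in J.
Proof.
set AQ := intmx rat A; set JM := (colmask _ _)^T; set al := (intmx rat alpha)^T.
move=> rn rkA rkJ alJ.
(* The first [t] chosen rows, padded with zero rows to a fixed shape. *)
pose U (f : nat -> 'I_m) t : 'M[rat]_n := \matrix_(i, j)
  (if nat_of_ord i == 0%N then al 0 j else if (i < t)%N then AQ (f i) j else 0).
have rkU f t : (0 < t)%N -> (t <= n)%N -> (\rank (U f t) <= t)%N.
  move=> t0 tn; have -> : U f t = (pid_mx t : 'M_n) *m U f t.
    apply/matrixP => i j; rewrite [RHS]mxE (bigD1 i) //= big1 ?addr0 => [|l li].
      rewrite mxE [X in X * _]mxE eqxx /=; case: (ltnP i t) => it; rewrite ?mul1r //.
      by rewrite mul0r gtn_eqF // (leq_trans t0).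
    by rewrite mxE eq_sym -val_eqE in li *; rewrite (negPf li) mul0r.
  by apply: leq_trans (mxrankM_maxl _ _) _; rewrite rank_pid_mx.
have n0 : (0 < n)%N by apply: leq_ltn_trans rn.
have m0 : (0 < m)%N by rewrite (leq_trans n0) // -rkA rank_leq_row.
have rowU0 f t : row (Ordinal n0) (U f t) = al.
  by apply/rowP => j; rewrite !mxE.
have claim t : (0 < t)%N -> (t <= n)%N -> exists f : nat -> 'I_m,
    (t <= \rank (U f t))%N /\ forall i, (0 < i < t)%N -> (i <= r)%N -> f i \in J.
  elim: t => // t IH _ tn; case: (posnP t) => [t0|t0].
    exists (fun _ => Ordinal m0); split; last by move=> i; lia.
    rewrite t0 lt0n mxrank_eq0; apply: contraNneq alJ => U0.
    by rewrite -(rowU0 (fun=> Ordinal m0) 1%N) U0 row0 sub0mx.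
  have [f [rkf fJ]] := IH t0 (ltnW tn).
  have rkE : \rank (U f t) = t by apply/eqP; rewrite eqn_leq rkf rkU // ltnW.
  have [i [iU iJ]] : exists i, ~~ (row i AQ <= U f t)%MS /\ ((t <= r)%N -> i \in J).
    case: (leqP t r) => tr.
      have : ~~ (JM <= U f t)%MS.
        apply/negP => JU.
        have alU : (al <= U f t)%MS by rewrite -(rowU0 f t) row_sub.
        have lt : (JM < al + JM)%MS.
          by rewrite ltmxE addsmxSr /=; apply: contra alJ; apply: submx_trans; apply: addsmxSl.
        have := rank_ltmx lt.
        have : (\rank (al + JM)%MS <= t)%N by rewrite -rkE mxrankS // addsmx_sub alU.
        by lia.
      case/row_subPn => i iU; have iJ : i \in J.
        apply: contraNT iU => iJ; suff -> : row i JM = 0 by rewrite sub0mx.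
        by apply/rowP => j; rewrite !mxE (negPf iJ).
      exists i; split=> //; apply: contra iU; suff -> : row i JM = row i AQ by [].
      by apply/rowP => j; rewrite !mxE iJ.
    have /row_subPn[i iU] : ~~ (AQ <= U f t)%MS.
      by apply/negP => /mxrankS; rewrite rkA rkE leqNgt tn.
    by exists i.
  pose f' j := if j == t then i else f j.
  exists f'; split; last first.
    move=> j jt jr; rewrite /f'; case: eqP => [jt'|/eqP jt']; first by apply: iJ; rewrite -jt'.
    by apply: fJ => //; lia.
  have UU : (U f t <= U f' t.+1)%MS.
    apply/row_subP => j; case: (altP (nat_of_ord j =P t)) => jt.
      suff -> : row j (U f t) = 0 by rewrite sub0mx.
      by apply/rowP => l; rewrite !mxE jt (gtn_eqF t0) ltnn.
    suff -> : row j (U f t) = row j (U f' t.+1) by rewrite row_sub.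
    by apply/rowP => l; rewrite !mxE /f' (negPf jt) ltnS (leq_eqVlt j) (negPf jt).
  have iU' : (row i AQ <= U f' t.+1)%MS.
    suff -> : row i AQ = row (Ordinal tn) (U f' t.+1) by rewrite row_sub.
    by apply/rowP => l; rewrite !mxE /f' eqxx ltnSn (gtn_eqF t0).
  rewrite -[X in (X < _)%N]rkE; apply: rank_ltmx; rewrite ltmxE UU /=.
  by apply: contra iU; apply: submx_trans.
have [f [rkf fJ]] := claim n n0 (leqnn n).
exists (fun i => f i); split; last first.
  by move=> i /andP[i0 ir]; apply: fJ => //; rewrite i0 ltn_ord.
have UE : U f n = intmx rat (alpha_mx alpha A (fun i => f i)).
  apply/matrixP => i j; rewrite !mxE; case: ifP => // _; by rewrite ltn_ord.
have : row_free (U f n) by rewrite -row_leq_rank.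
by rewrite row_free_unit unitmxE UE det_intmx unitfE intr_eq0.
Qed.

Lemma det_mx2 (R : comNzRingType) (M : 'M[R]_2) :
  \det M = M 0 0 * M 1 1 - M 0 1 * M 1 0.
Proof.
rewrite (expand_det_row _ 0) !big_ord_recl big_ord0 addr0 /cofactor !det_mx11 !mxE /=.
rewrite expr0 mul1r expr1 mulN1r mulrN.
congr (_ * M _ _ - M _ _ * M _ _); apply: val_inj => //=.
Qed.

Section Minors.
Variables (m n0 k : nat) (A : 'M[int]_(m, n0 + k)) (alpha : 'cV[int]_(n0 + k)).
Variables (f : {ffun 'I_(n0 + k) -> 'I_m}) (J : {set 'I_m}).
Let fam (g : {ffun 'I_(n0 + k) -> 'I_m}) :=
  forall i : 'I_(n0 + k), (0 < i < n0)%N -> g i \in J.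
Let B := alpha_mx alpha A f.
Let mu := rsubmx (intmx rat A *m invmx (intmx rat B)).
Hypotheses (n0_gt0 : (0 < n0)%N) (detB : \det B != 0) (famf : fam f).
Hypothesis fmax : forall g : {ffun 'I_(n0 + k) -> 'I_m}, fam g ->
  (`|\det (alpha_mx alpha A g)| <= `|\det B|)%N.

Let BQu : intmx rat B \in unitmx.
Proof. by rewrite unitmxE det_intmx unitfE intr_eq0. Qed.

(** Rows of [mu] are the last [k] coordinates of rows of [A] in the basis of rows of [B]. By
    Cramer's rule, replacing the last [k] rows of [B] by the rows [g] multiplies the determinant by
    this minor, so maximality bounds it. *)
Lemma minor_le1 (g : 'I_k -> 'I_m) : `|\det (rowsub g mu)| <= 1.
Proof.
pose f' : {ffun 'I_(n0 + k) -> 'I_m} :=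
  [ffun i => match split i with inl j => f i | inr l => g l end].
have f'L i : f' (lshift k i) = f (lshift k i) by rewrite ffunE (unsplitK (inl i)).
have f'R l : f' (rshift n0 l) = g l by rewrite ffunE (unsplitK (inr l)).
have famf' : fam f'.
  move=> i; rewrite -(splitK i); case: (split i) => l /= li; last by lia.
  by rewrite f'L; apply: famf.
pose Q := intmx rat (alpha_mx alpha A f') *m invmx (intmx rat B).
have QE : Q = block_mx 1%:M 0 (dlsubmx Q) (rowsub g mu).
  rewrite -[LHS]submxK; congr block_mx.
  - apply/matrixP => i j; rewrite !mxE.
    transitivity ((intmx rat B *m invmx (intmx rat B)) (lshift k i) (lshift k j)).
      by rewrite [RHS]mxE; apply: eq_bigr => l _; rewrite !mxE f'L.
    by rewrite mulmxV // !mxE -val_eqE.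
  - apply/matrixP => i j; rewrite !mxE.
    transitivity ((intmx rat B *m invmx (intmx rat B)) (lshift k i) (rshift n0 j)).
      by rewrite [RHS]mxE; apply: eq_bigr => l _; rewrite !mxE f'L.
    rewrite mulmxV // !mxE -val_eqE /= ltn_eqF //.
    by rewrite (leq_trans (ltn_ord i)) // leq_addr.
  - apply/matrixP => i j; rewrite !mxE.
    by apply: eq_bigr => l _; rewrite !mxE f'R /= addn_eq0 (gtn_eqF n0_gt0).
have := fmax famf'; rewrite -(ler_nat rat) !natr_absz !intr_norm -!det_intmx.
have -> : intmx rat (alpha_mx alpha A f') = Q *m intmx rat B by rewrite mulmxKV.
rewrite det_mulmx {1}QE det_lblock det1 mul1r normrM ger_pMl //.
by rewrite normr_gt0 det_intmx intr_eq0.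
Qed.

Lemma mu_unit l l' : mu (f (rshift n0 l)) l' = (l == l')%:R.
Proof.
transitivity ((intmx rat B *m invmx (intmx rat B)) (rshift n0 l) (rshift n0 l')).
  rewrite !mxE; apply: eq_bigr => j _; rewrite !mxE /=.
  by rewrite addn_eq0 (gtn_eqF n0_gt0).
by rewrite mulmxV // !mxE -val_eqE /= eqn_add2l.
Qed.
End Minors.

Definition zero_rows m n (A : 'M[int]_(m, n)) (p : 'cV[rat]_n) : {set 'I_m} :=
  [set i | (intmx rat A *m p) i 0 == 0].

Lemma dotE (R : realFieldType) n (alpha : 'cV[int]_n) (x : 'cV[R]_n) :
  dot alpha x = ((intmx R alpha)^T *m x) 0 0.
Proof. by rewrite mxE; apply: eq_bigr => j _; rewrite !mxE. Qed.

Lemma max_minor m n0 k (A : 'M[int]_(m, n0 + k)) (alpha : 'cV[int]_(n0 + k))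
    (p : 'cV[rat]_(n0 + k)) (J := zero_rows A p) :
  (0 < n0)%N -> \rank (intmx rat A) = (n0 + k)%N -> dot alpha p != 0 ->
  (n0.-1 <= \rank (colmask (intmx rat A)^T J)^T)%N ->
  exists f : {ffun 'I_(n0 + k) -> 'I_m}, [/\ \det (alpha_mx alpha A f) != 0,
    forall i : 'I_(n0 + k), (0 < i < n0)%N -> f i \in J &
    forall g : {ffun 'I_(n0 + k) -> 'I_m},
      (forall i : 'I_(n0 + k), (0 < i < n0)%N -> g i \in J) ->
      (`|\det (alpha_mx alpha A g)| <= `|\det (alpha_mx alpha A f)|)%N].
Proof.
move=> n0_gt0 rkA ap0 rkJ.
have alJ : ~~ ((intmx rat alpha)^T <= (colmask (intmx rat A)^T J)^T)%MS.
  apply: contra ap0 => /submxP[c cE]; rewrite dotE cE -mulmxA.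
  suff -> : (colmask (intmx rat A)^T J)^T *m p = 0 by rewrite mulmx0 mxE.
  apply/colP => i; rewrite [LHS]mxE [RHS]mxE; case: (boolP (i \in J)) => iJ.
    transitivity ((intmx rat A *m p) i 0); last by apply/eqP; rewrite inE in iJ.
    by rewrite [RHS]mxE; apply: eq_bigr => j _; rewrite !mxE iJ.
  by rewrite big1 // => j _; rewrite !mxE (negPf iJ) mul0r.
have [|f [detf fJ]] := select_rows _ rkA rkJ alJ; first by lia.
pose fam (g : {ffun 'I_(n0 + k) -> 'I_m}) :=
  [forall i : 'I_(n0 + k), (0 < i < n0)%N ==> (g i \in J)].
have famP g : fam g <-> (forall i : 'I_(n0 + k), (0 < i < n0)%N -> g i \in J).
  split=> [/forallP h i|h]; first by apply/implyP.
  by apply/forallP => i; apply/implyP; apply: h.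
have fam0 : fam (finfun f) by apply/famP => i i0; rewrite ffunE; apply: fJ; lia.
have [g /famP famg gmax] := arg_maxnP
  (fun g : {ffun 'I_(n0 + k) -> 'I_m} => `|\det (alpha_mx alpha A g)|%N) fam0.
exists g; split=> // [|h /famP /gmax //].
have := gmax _ fam0; rewrite -!absz_gt0 in detf *; apply: leq_trans.
suff -> : alpha_mx alpha A (finfun f) = alpha_mx alpha A f by [].
by apply/matrixP => i j; rewrite !mxE ffunE.
Qed.

Lemma det_le_Delta m n (A : 'M[int]_(m, n)) alpha (f : {ffun 'I_n -> 'I_m}) :
  (`|\det (alpha_mx alpha A f)| <= Delta_alpha alpha A)%N.
Proof.
exact: (leq_bigmax (F := fun f : {ffun 'I_n -> 'I_m} => `|\det (alpha_mx alpha A f)|%N)).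
Qed.

(** * Pieces on faces of dimension two and three *)

Lemma plane_piece m n0 (A : 'M[int]_(m, n0 + 1)) (alpha : 'cV[int]_(n0 + 1))
    (p : 'cV[rat]_(n0 + 1)) :
  (0 < n0)%N -> \rank (intmx rat A) = (n0 + 1)%N -> (0 < Delta_alpha alpha A)%N ->
  (n0.-1 <= \rank (colmask (intmx rat A)^T (zero_rows A p))^T)%N ->
  lattice_free A p ->
  `|dot alpha p| < (Delta_alpha alpha A)%:R.
Proof.
move=> n0_gt0 rkA D0 rkJ free; rewrite ltNge; apply/negP => le.
have ap0 : dot alpha p != 0.
  by rewrite -normr_gt0; apply: lt_le_trans le; rewrite ltr0n.
have [f [detf fJ fmax]] := max_minor n0_gt0 rkA ap0 rkJ.
have [T [T0 TP]] := common_denominator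
  (fun l : 'I_1 => (intmx rat A *m p) (f (rshift n0 l)) 0 / `|dot alpha p|).
have T0' : 0 < T%:R :> rat by rewrite ltr0n.
(* For [k = 1] the entries of [mu] are at most 1 in absolute value, so [T] consecutive integers
   serve; the count reduces to [|det B| <= sig]. *)
pose y (s : 'I_T) : 'cV[int]_1 := const_mx (s : nat)%:Z.
pose sig := Num.truncn `|dot alpha p|.
have sigP : sig%:R <= `|dot alpha p| by rewrite truncn_le.
apply: (@pigeonhole_bound m n0 1 A alpha p f n0_gt0 detf ap0 _ 'I_T y T sig) => //.
- by move=> i /fJ; rewrite inE => /eqP.
- by move=> s s' /colP/(_ 0); rewrite !mxE => -[] ss'; apply: val_inj.
- by move=> l; apply: TP.
- move=> s s' i; rewrite mxE big_ord1.
  have := minor_le1 n0_gt0 detf fJ fmax (fun=> i); rewrite det_mx11 [X in `|X|]mxE.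
  move: (rsubmx _ i 0) => c c1; rewrite normrM !mxE.
  apply: le_lt_trans (_ : `|((s : nat)%:Z - (s' : nat)%:Z)%:~R : rat| < _).
    by rewrite ler_piMl.
  rewrite -intr_norm; have -> : T%:R = T%:Z%:~R :> rat by [].
  by rewrite ltr_int; have := ltn_ord s; have := ltn_ord s'; lia.
rewrite card_ord expn1 mulnC ltn_pmul2r // ltnS.
apply: leq_trans (det_le_Delta _ _ _) _.
by rewrite /sig truncn_ge_nat.
Qed.

Lemma space_piece m n0 (A : 'M[int]_(m, n0 + 2)) (alpha : 'cV[int]_(n0 + 2))
    (p : 'cV[rat]_(n0 + 2)) :
  (0 < n0)%N -> \rank (intmx rat A) = (n0 + 2)%N -> (0 < Delta_alpha alpha A)%N ->
  (n0.-1 <= \rank (colmask (intmx rat A)^T (zero_rows A p))^T)%N ->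
  lattice_free A p ->
  3%:R * `|dot alpha p| < 4%:R * (Delta_alpha alpha A)%:R.
Proof.
move=> n0_gt0 rkA D0 rkJ free; rewrite ltNge; apply/negP => le.
have ap0 : dot alpha p != 0.
  rewrite -normr_gt0 -(pmulr_rgt0 _ (_ : 0 < 3%:R)) //.
  by apply: lt_le_trans le; rewrite mulr_gt0 // ltr0n.
have [f [detf fJ fmax]] := max_minor n0_gt0 rkA ap0 rkJ.
have [q0 [q0_gt0 qP]] := common_denominator
  (fun l : 'I_2 => (intmx rat A *m p) (f (rshift n0 l)) 0 / `|dot alpha p|).
pose sig := Num.truncn `|dot alpha p|.
have sigP : sig%:R <= `|dot alpha p| by rewrite truncn_le.
set mu := rsubmx (intmx rat A *m invmx (intmx rat (alpha_mx alpha A f))).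
(* Taking each row of [mu] with both signs makes the planar set symmetric. Its required inequality
   follows from [4 |det B| <= 4 Delta <= 3 |alpha p| < 3 (sig + 1)]. *)
pose sg (c : bool) : rat := if c then -1 else 1.
pose a (ic : 'I_m * bool) := sg ic.2 * mu ic.1 0.
pose b (ic : 'I_m * bool) := sg ic.2 * mu ic.1 1.
pose e1 := (f (rshift n0 0), false); pose e2 := (f (rshift n0 1), false).
have muE := mu_unit n0_gt0 detf.
have [||||||||T [Y [y [[T0 qT] y_inj Yd cY]]]] :=
    @polar_lattice_points _ a b e1 e2 _ _ _ _ _ _ q0 sig.+1 `|\det (alpha_mx alpha A f)|%N.
- by rewrite /a /= mul1r muE.
- by rewrite /b /= mul1r muE.
- by rewrite /a /= mul1r muE.
- by rewrite /b /= mul1r muE.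
- by move=> [i c]; exists (i, ~~ c); rewrite /a /b /sg /=; case: c => /=; split; ring.
- move=> [i c] [j d].
  have := minor_le1 n0_gt0 detf fJ fmax
    (fun l : 'I_2 => if l == 0 then i else j); rewrite det_mx2 -/mu.
  rewrite [rowsub _ _ 0 0]mxE [rowsub _ _ 1 1]mxE [rowsub _ _ 0 1]mxE [rowsub _ _ 1 0]mxE.
  rewrite ler_norml /a /b /sg /= => /andP[l1 l2].
  by case: c; case: d => /=; lra.
- exact: q0_gt0.
- rewrite -(ltr_nat rat) !natrM.
  have : `|dot alpha p| < sig.+1%:R by apply: truncnS_gt.
  have : `|\det (alpha_mx alpha A f)|%:R <= (Delta_alpha alpha A)%:R :> rat.
    by rewrite ler_nat det_le_Delta.
  by lra.
pose yv (s : Y) : 'cV[int]_2 := \col_l (if l == 0 then (y s).1 else (y s).2).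
apply: (@pigeonhole_bound m n0 2 A alpha p f n0_gt0 detf ap0 _ Y yv T sig) => //.
- by move=> i /fJ; rewrite inE => /eqP.
- move=> s s' E; apply: y_inj; move/colP: E => E.
  have := E 0; have := E 1; rewrite !mxE /=.
  by case: (y s) (y s') => [s1 s2] [t1 t2] /= -> ->.
- by move=> l; apply: qP.
- move=> s s' i; rewrite mxE !big_ord_recl big_ord0 addr0.
  rewrite [intmx _ _ _ _]mxE [intmx _ _ _ _]mxE [(yv s - yv s') _ _]mxE [(yv s - yv s') _ _]mxE.
  rewrite ![yv _ _ _]mxE ![(- yv _) _ _]mxE ![yv _ _ _]mxE /= -/mu.
  have := Yd s s' (i, false); have := Yd s s' (i, true); rewrite /a /b /sg /=.
  have -> : lift 0 0 = 1 :> 'I_2 by apply: val_inj.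
  by rewrite ltr_norml => h1 h2; apply/andP; split; lra.
by rewrite mulnC.
Qed.

(** * Proximity over the rationals *)

Lemma ex_minimal (X : Type) (P : X -> Prop) (mu : X -> nat) :
  (exists x, P x) -> exists x, P x /\ forall y, P y -> (mu x <= mu y)%N.
Proof.
case=> x Px; have [k] := ubnP (mu x); elim: k x Px => // k IH x Px lek.
have [[y [Py lt]]|nex] := classic (exists y, P y /\ (mu y < mu x)%N).
  by apply: (IH y Py); apply: leq_trans lt _.
exists x; split=> // y Py; rewrite leqNgt; apply/negP => lt.
by apply: nex; exists y.
Qed.

Lemma Delta_alpha_gt0 m n (A : 'M[int]_(m, n)) (alpha : 'cV[int]_n) :
  \rank (intmx rat A) = n -> alpha != 0 -> (0 < Delta_alpha alpha A)%N.
Proof.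
move=> rkA al0.
have n0 : (0 < n)%N.
  case: n A alpha rkA al0 => // A alpha _ /eqP[]; apply/matrixP => -[] //.
have mask0 : (colmask (intmx rat A)^T set0)^T = 0.
  by apply/matrixP => i j; rewrite !mxE inE.
have [||f [detf _]] := @select_rows m n A alpha set0 0 n0 rkA; first by [].
  rewrite mask0; apply: contra al0 => /submx0null E; apply/eqP/colP => j.
  have /eqP := congr1 (fun M : 'rV[rat]_n => M 0 j) E.
  by rewrite !mxE intr_eq0 => /eqP.
apply: leq_trans (det_le_Delta A alpha (finfun f)).
rewrite absz_gt0; suff -> : alpha_mx alpha A (finfun f) = alpha_mx alpha A f by [].
by apply/matrixP => i j; rewrite !mxE ffunE.
Qed.

Lemma objD (R : realFieldType) n (c : 'cV[rat]_n) (x y : 'cV[R]_n) :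
  obj c (x + y) = obj c x + obj c y.
Proof.
by rewrite /obj -big_split; apply: eq_bigr => j _; rewrite mxE mulrDr.
Qed.

Lemma objZ (R : realFieldType) n (c : 'cV[rat]_n) (a : R) (x : 'cV[R]_n) :
  obj c (a *: x) = a * obj c x.
Proof.
by rewrite /obj mulr_sumr; apply: eq_bigr => j _; rewrite mxE mulrCA.
Qed.

(** Objective values at integer points are multiples of [1 / D] and bounded above, so an improvement
    strictly lowers the truncation of [D * (M - obj)]. *)
Lemma ip_optimal_exists m n (A : 'M[int]_(m, n)) (b : 'cV[int]_m) (c : 'cV[rat]_n)
    (M : rat) :
  (forall z : 'cV[int]_n, feasible A b (intmx rat z) -> obj c (intmx rat z) <= M) ->
  (exists z : 'cV[int]_n, feasible A b (intmx rat z)) ->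
  exists z, ip_optimal rat A b c z.
Proof.
move=> bound feas.
have [D [D0 DP]] := common_denominator (fun j => c j 0).
have D0' : 0 < D%:R :> rat by rewrite ltr0n.
have int_obj (z : 'cV[int]_n) : exists w : int, D%:R * obj c (intmx rat z) = w%:~R.
  have [w wE] := fin_all_exists (fun j => DP D j (dvdnn D)).
  exists (\sum_j w j * z j 0); rewrite /obj mulr_sumr rmorph_sum /=.
  apply: eq_bigr => j _; rewrite mxE mulrA intrM -wE; congr (_ * _ * _).
  by rewrite -(fmorph_eq_rat idfun).
pose mu (z : 'cV[int]_n) := Num.truncn (D%:R * (M - obj c (intmx rat z))).
have [z [fz zmin]] := ex_minimal mu feas.
exists z; split=> // y fy; rewrite leNgt; apply/negP => lt.
have := zmin y fy; rewrite leqNgt => /negP; apply.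
have [w wE] := int_obj z; have [v vE] := int_obj y.
have wv : w < v by rewrite -(ltr_int rat) -wE -vE ltr_pM2l.
have vw : w%:~R + 1 <= v%:~R :> rat.
  by rewrite -[1]/(1%:~R) -intrD ler_int; lia.
have y0 : 0 <= D%:R * (M - obj c (intmx rat y)).
  by apply: mulr_ge0; [exact: ltW | rewrite subr_ge0; exact: bound].
have h1 : D%:R * (M - obj c (intmx rat z)) < (mu z)%:R + 1 by rewrite natr1 truncnS_gt.
have h2 : (mu y)%:R <= D%:R * (M - obj c (intmx rat y)) by rewrite truncn_le.
rewrite -(ltr_nat rat); move: h1 h2; rewrite !mulrBr vE wE.
by move: (mu z)%:R (mu y)%:R => mz my; lra.
Qed.

Lemma plane_bound m n (A : 'M[int]_(m, n)) (alpha : 'cV[int]_n) (p : 'cV[rat]_n) :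
  (2 <= n)%N -> \rank (intmx rat A) = n -> (0 < Delta_alpha alpha A)%N ->
  (n <= \rank (colmask (intmx rat A)^T (zero_rows A p))^T + 2)%N ->
  lattice_free A p -> `|dot alpha p| < (Delta_alpha alpha A)%:R.
Proof.
move=> n2; have [n0 E] : exists n0, n = (n0 + 1)%N by exists n.-1; lia.
by subst n => rkA D0 rkJ; apply: plane_piece => //; lia.
Qed.

Lemma space_bound m n (A : 'M[int]_(m, n)) (alpha : 'cV[int]_n) (p : 'cV[rat]_n) :
  (3 <= n)%N -> \rank (intmx rat A) = n -> (0 < Delta_alpha alpha A)%N ->
  (n <= \rank (colmask (intmx rat A)^T (zero_rows A p))^T + 3)%N ->
  lattice_free A p -> 3%:R * `|dot alpha p| < 4%:R * (Delta_alpha alpha A)%:R.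
Proof.
move=> n2; have [n0 E] : exists n0, n = (n0 + 2)%N by exists n.-2; lia.
by subst n => rkA D0 rkJ; apply: space_piece => //; lia.
Qed.

(** * Decomposing the displacement *)

Section Spindle.
Variables (m n : nat) (A : 'M[int]_(m, n)) (d : 'cV[rat]_n).
Let AQ := intmx rat A.
Let sgn i : rat := if 0 <= (AQ *m d) i 0 then 1 else -1.

(* The columns are the rows of [A], signed so that [d] lies in the cone. *)
Definition spindle_mx : 'M[rat]_(n, m) := \matrix_(j, i) (sgn i * AQ i j).

Lemma mul_spindle_mx (x : 'rV[rat]_n) i : (x *m spindle_mx) 0 i = sgn i * (AQ *m x^T) i 0.
Proof.
rewrite [LHS]mxE [X in _ = _ * X]mxE mulr_sumr; apply: eq_bigr => j _.
by rewrite [spindle_mx _ _]mxE [x^T _ _]mxE; ring.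
Qed.

Let sgn_neq0 i : sgn i != 0. Proof. by rewrite /sgn; case: ifP. Qed.

Lemma cone_spindle : cone spindle_mx d^T.
Proof.
by move=> i; rewrite mul_spindle_mx trmxK /sgn; case: (lerP 0 ((AQ *m d) i 0)); lra.
Qed.

Lemma spindle_mx_inj (w : 'rV[rat]_n) : \rank AQ = n -> w *m spindle_mx = 0 -> w = 0.
Proof.
move=> rkA E; have AQt : row_free AQ^T by rewrite /row_free mxrank_tr rkA.
apply/eqP; rewrite -(mulmx_free_eq0 _ AQt); apply/eqP/rowP => i.
have := mul_spindle_mx w i; rewrite E [LHS]mxE => /esym/eqP.
rewrite mulf_eq0 (negPf (sgn_neq0 i)) /= => /eqP h.
rewrite -[w]trmxK -trmx_mul [LHS]mxE [RHS]mxE; exact: h.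
Qed.

Lemma tight_spindle (x : 'rV[rat]_n) : tight spindle_mx 0 x = zero_rows A x^T.
Proof.
by apply/setP => i; rewrite in_tight0 inE mul_spindle_mx mulf_eq0 (negPf (sgn_neq0 i)).
Qed.

Lemma fdim_spindle (x : 'rV[rat]_n) :
  (fdim spindle_mx x + \rank (colmask AQ^T (zero_rows A x^T))^T = n)%N.
Proof.
set J := zero_rows A x^T.
have E : \rank (ann spindle_mx J) = \rank (ann AQ^T J).
  have AE (v : 'rV_n) i : (v *m AQ^T) 0 i = (AQ *m v^T) i 0.
    by rewrite -[v in LHS]trmxK -trmx_mul [LHS]mxE.
  apply/eqP; rewrite eqn_leq; apply/andP; split; apply: mxrankS; apply/rV_subP => v /annP h.
    apply/annP => i /h; rewrite mul_spindle_mx AE => /eqP.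
    by rewrite mulf_eq0 (negPf (sgn_neq0 i)) => /eqP.
  by apply/annP => i /h; rewrite mul_spindle_mx AE => ->; rewrite mulr0.
rewrite /fdim tight_spindle -/J E mxrank_ker mxrank_tr subnK //.
exact: rank_leq_row.
Qed.

Variable alpha : 'cV[int]_n.
Hypotheses (n_ge2 : (2 <= n)%N) (rkA : \rank AQ = n) (D_gt0 : (0 < Delta_alpha alpha A)%N).
Hypothesis free : forall p, cone spindle_mx p -> cone spindle_mx (d^T - p) ->
  lattice_free A p^T.

Let coneD x y : cone spindle_mx x -> cone spindle_mx y -> cone spindle_mx (x + y).
Proof. by move=> h1 h2 i; rewrite mulmxDl [X in _ <= X]mxE addr_ge0. Qed.

Let dotD (x y : 'rV[rat]_n) : dot alpha (x + y)^T = dot alpha x^T + dot alpha y^T.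
Proof. by rewrite !dotE linearD mulmxDr [LHS]mxE. Qed.

(** Measured in ninths of [Del], a plane piece costs 9 and a space piece 12, the growth of
    [4 * r + 2] when [r] increases by 3. The base cases need 9 <= 10, 12 <= 14 and, for [r = 4]
    split into two planes, 18 <= 18. *)
Lemma spindle_bound r e : (2 <= r <= n)%N ->
  cone spindle_mx e -> cone spindle_mx (d^T - e) -> (fdim spindle_mx e <= r)%N ->
  9%:R * `|dot alpha e^T| < (4 * r + 2)%:R * (Delta_alpha alpha A)%:R.
Proof.
set Del : rat := (Delta_alpha alpha A)%:R.
have Del0 : 0 < Del by rewrite ltr0n.
have plane p : cone spindle_mx p -> cone spindle_mx (d^T - p) ->
    (fdim spindle_mx p <= 2)%N -> `|dot alpha p^T| < Del.
  move=> C1 C2 fp; apply: plane_bound => //; last exact: free.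
  by rewrite -[X in (X <= _)%N](fdim_spindle p) addnC leq_add2l.
have space p : (3 <= n)%N -> cone spindle_mx p -> cone spindle_mx (d^T - p) ->
    (fdim spindle_mx p <= 3)%N -> 3%:R * `|dot alpha p^T| < 4%:R * Del.
  move=> n3 C1 C2 fp; apply: space_bound => //; last exact: free.
  by rewrite -[X in (X <= _)%N](fdim_spindle p) addnC leq_add2l.
have split k r' x : cone spindle_mx x -> cone spindle_mx (d^T - x) ->
    (fdim spindle_mx x <= r')%N -> (k <= r')%N -> exists p q,
    [/\ cone spindle_mx p, cone spindle_mx (d^T - p) & (fdim spindle_mx p <= k)%N] /\
    [/\ cone spindle_mx q, cone spindle_mx (d^T - q), (fdim spindle_mx q <= r' - k)%N
      & `|dot alpha x^T| <= `|dot alpha p^T| + `|dot alpha q^T|].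
  move=> C1 C2 fx kr.
  have [p [Cp Cq fp fq]] := cone_split (fun w => @spindle_mx_inj w rkA) C1 fx kr.
  exists p, (x - p); split; split=> //.
  - by have := coneD C2 Cq; rewrite addrA subrK.
  - by have := coneD C2 Cp; rewrite opprB addrA addrAC.
  - by rewrite -{1}(subrKC p x) dotD ler_normD.
elim/ltn_ind: r e => r IH e /andP[r2 rn] C1 C2 fe.
have [r_2|[r_3|[r_4|r_5]]] : r = 2 \/ r = 3 \/ r = 4 \/ (5 <= r)%N by lia.
- by have := plane e C1 C2; rewrite r_2 in fe *; move=> /(_ fe); rewrite natrD natrM; lra.
- have := space e _ C1 C2; rewrite r_3 in rn fe *.
  by move=> /(_ rn fe); rewrite natrD natrM; lra.
- have [p [q [[p1 p2 p3] [q1 q2 q3 le]]]] := split 2%N r e C1 C2 fe r2.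
  have := plane p p1 p2 p3; have := plane q q1 q2; rewrite r_4 in q3 *.
  by move=> /(_ q3); rewrite natrD natrM; lra.
have r3 : (3 <= r)%N by lia.
have [p [q [[p1 p2 p3] [q1 q2 q3 le]]]] := split 3%N r e C1 C2 fe r3.
have := space p (leq_trans r3 rn) p1 p2 p3.
have := IH (r - 3)%N _ q _ q1 q2 q3.
move=> /(_ ltac:(lia) ltac:(lia)).
have -> : (4 * r + 2 = (4 * (r - 3) + 2) + 12)%N by lia.
by rewrite [X in _ -> _ -> _ < X * _]natrD mulrDl; lra.
Qed.

End Spindle.

Lemma intmx_mulE (R : realFieldType) m n (A : 'M[int]_(m, n)) (z : 'cV[int]_n) i :
  (intmx R A *m intmx R z) i 0 = ((A *m z) i 0)%:~R.
Proof. by rewrite -intmxM mxE. Qed.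

Lemma tight_rows_inj (R : realFieldType) m n (A : 'M[int]_(m, n)) b (x y : 'cV[R]_n) :
  vertex A b x ->
  (forall i, (intmx R A *m x) i 0 = (b i 0)%:~R -> (intmx R A *m y) i 0 = 0) -> y = 0.
Proof.
move=> [_ rk] H; apply: trmx_inj; rewrite trmx0; apply/eqP.
have fr : row_free (tight_rows A b x)^T by rewrite /row_free mxrank_tr rk.
rewrite -(mulmx_free_eq0 _ fr) -trmx_mul; apply/eqP/rowP => i.
rewrite [LHS]mxE [RHS]mxE [LHS]mxE.
case: (altP ((intmx R A *m x) i 0 =P (b i 0)%:~R)) => [E|nE].
  by rewrite -[RHS](H i E) [RHS]mxE; apply: eq_bigr => j _;
    rewrite [tight_rows _ _ _ _ _]mxE E eqxx.
by rewrite big1 // => j _; rewrite [tight_rows _ _ _ _ _]mxE (negPf nE) mul0r.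
Qed.

(** * Lattice-freeness at a minimal optimum *)

Section Optimality.
Variables (m n : nat) (A : 'M[int]_(m, n)) (b : 'cV[int]_m) (c : 'cV[rat]_n).
Variable xs : 'cV[rat]_n.
Hypothesis opt_xs : lp_optimal_vertex A b c xs.
Let AQ := intmx rat A.
Let tight_at i := (AQ *m xs) i 0 == (b i 0)%:~R.

(** A small step from [xs] along [- u] stays feasible, so by optimality of [xs] it cannot increase
    the objective. *)
Lemma obj_ge0 (u : 'cV[rat]_n) :
  (forall i, tight_at i -> 0 <= (AQ *m u) i 0) -> 0 <= obj c u.
Proof.
have [[feas _] opt] := opt_xs.
move=> tight_u.
suff [eps eps0 epsP] : exists2 eps : rat, 0 < eps &
    forall i, 0 <= (b i 0)%:~R - (AQ *m xs) i 0 + eps * (AQ *m u) i 0.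
  have : obj c (xs - eps *: u) <= obj c xs.
    apply: opt => i; have := epsP i.
    rewrite mulmxBr -scalemxAr [X in _ -> X <= _]mxE [X in _ -> _ + X <= _]mxE.
    by rewrite [X in _ -> _ - X <= _]mxE -/AQ; lra.
  by rewrite -scaleNr objD objZ -subr_ge0; have := pmulr_rge0 (obj c u) eps0; lra.
have slack i : 0 <= (b i 0)%:~R - (AQ *m xs) i 0 by rewrite subr_ge0 feas.
case: (boolP [exists i, (AQ *m u) i 0 < 0]) => [/existsP[i ui]|nex].
  have [t [j [t0 tP uj E]]] := ratio_test (v := fun i => (AQ *m u) i 0) slack ui.
  exists t => //; rewrite lt_neqAle t0 andbT; apply/eqP => t00.
  have /tight_u : tight_at j by rewrite /tight_at eq_sym -subr_eq0 -E -t00 mul0r addr0.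
  by rewrite leNgt uj.
exists 1 => // i; rewrite mul1r addr_ge0 //.
by move: nex; rewrite negb_exists => /forallP/(_ i); rewrite -leNgt.
Qed.

Let excess (z : 'cV[int]_n) : nat := (\sum_(i | tight_at i) `|(b i 0 - (A *m z) i 0)%R|)%N.

Lemma minimal_lattice_free z :
  ip_optimal rat A b c z ->
  (forall y, ip_optimal rat A b c y -> (excess z <= excess y)%N) ->
  forall p, cone (spindle_mx A (xs - intmx rat z)) p ->
    cone (spindle_mx A (xs - intmx rat z)) ((xs - intmx rat z)^T - p) ->
    lattice_free A p^T.
Proof.
move=> [fz optz] zmin p Cp Cdp u t u0 /andP[t0 t1] H.
have [[feas rk] opt] := opt_xs.
have dE i : (AQ *m (xs - intmx rat z)) i 0 = (AQ *m xs) i 0 - ((A *m z) i 0)%:~R.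
  by rewrite mulmxBr [LHS]mxE [X in _ + X]mxE intmx_mulE.
have uE i : (AQ *m intmx rat u) i 0 = ((A *m u) i 0)%:~R by rewrite intmx_mulE.
have zuE i : (A *m (z + u)) i 0 = (A *m z) i 0 + (A *m u) i 0.
  by rewrite mulmxDr [LHS]mxE.
have fzi i : (A *m z) i 0 <= b i 0 by have := fz i; rewrite intmx_mulE ler_int.
have bounds i : if 0 <= (AQ *m (xs - intmx rat z)) i 0
   then 0 <= (AQ *m p^T) i 0 <= (AQ *m (xs - intmx rat z)) i 0
   else (AQ *m p^T) i 0 <= 0.
  have := Cp i; have := Cdp i; rewrite !mul_spindle_mx [(_ - p)^T]linearB /= trmxK.
  have -> : (intmx rat A *m (xs - intmx rat z - p^T)) i 0 =
      (AQ *m (xs - intmx rat z)) i 0 - (AQ *m p^T) i 0.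
    by rewrite mulmxBr [LHS]mxE [X in _ + X]mxE.
  rewrite -/AQ.
  by case: ifP => _; lra.
(* Where [A d >= 0], with [d = xs - z], closeness of [u] to [t p] gives
   [A (z + u) < A xs + 1 <= b + 1]; elsewhere [A u < 1]. Integrality removes the 1. *)
have up i : (A *m (z + u)) i 0 <= b i 0.
  have := H i; have := bounds i; rewrite -/AQ uE ltr_norml => bd /andP[_ lt].
  case: (lerP 0 ((AQ *m (xs - intmx rat z)) i 0)) bd => _ bd.
    have /andP[p0 p1] := bd.
    have tp : t * (AQ *m p^T) i 0 <= (AQ *m p^T) i 0 by rewrite ler_piMl.
    have fi := feas i; rewrite -/AQ in fi; rewrite dE in p1.
    have : ((A *m (z + u)) i 0)%:~R < (b i 0)%:~R + 1 :> rat by rewrite zuE intrD; lra.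
    by rewrite -[1]/(1%:~R) -intrD ltr_int ltzD1.
  have tp : t * (AQ *m p^T) i 0 <= 0 by rewrite mulr_ge0_le0.
  have : (A *m u) i 0 < 1 -> (A *m (z + u)) i 0 <= b i 0.
    by rewrite zuE; have := fzi i; lia.
  by apply; rewrite -(ltr_int rat); lra.
have low i : tight_at i -> 0 <= (A *m u) i 0.
  move=> /eqP ti; have := H i; have := bounds i; rewrite -/AQ uE ltr_norml => bd /andP[lt _].
  have d0 : 0 <= (AQ *m (xs - intmx rat z)) i 0.
    by rewrite dE ti subr_ge0 ler_int.
  rewrite d0 in bd; have /andP[p0 _] := bd.
  have tp : 0 <= t * (AQ *m p^T) i 0 by rewrite mulr_ge0.
  have : -1 < (A *m u) i 0 -> 0 <= (A *m u) i 0 by lia.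
  by apply; rewrite -(ltr_int rat) mulrNz; lra.
have opt_zu : ip_optimal rat A b c (z + u).
  split=> [i|y fy]; first by rewrite intmx_mulE ler_int.
  apply: le_trans (optz y fy) _; rewrite intmxD objD lerDl.
  by apply: obj_ge0 => i ti; rewrite uE ler0z low.
have := zmin _ opt_zu; rewrite leqNgt => /negP; apply.
(* The rows tight at a vertex have full rank, so they cannot all vanish on [u]; the excess of
   [z + u] is then strictly smaller. *)
have [i0 ti0 ui0] : exists2 i, tight_at i & 0 < (A *m u) i 0.
  apply/exists_inP; apply: contraNT u0; rewrite negb_exists_in => /forall_inP nex.
  have : intmx rat u = 0.
    apply: (tight_rows_inj (proj1 opt_xs)) => i /eqP ti.
    rewrite uE; apply/eqP; rewrite intr_eq0 eq_le low // andbT leNgt.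
    exact: nex.
  move=> E; apply/eqP/colP => j; apply/eqP; rewrite [X in _ == X]mxE -(intr_eq0 rat).
  by have := congr1 (fun M : 'cV[rat]_n => M j 0) E; rewrite !mxE => ->.
rewrite /excess (bigD1 i0 ti0) [X in (_ < X)%N](bigD1 i0 ti0) /= -addSn.
apply: leq_add.
  move: (up i0) (fzi i0) ui0; rewrite zuE.
  move: (b i0 0) ((A *m z) i0 0) ((A *m u) i0 0) => B Z U; lia.
apply: leq_sum => i /andP[ti _].
move: (up i) (fzi i) (low i ti); rewrite zuE.
by move: (b i 0) ((A *m z) i 0) ((A *m u) i 0) => B Z U; lia.
Qed.

Lemma proximity_rat (alpha : 'cV[int]_n) :
  (2 <= n)%N -> \rank (intmx rat A) = n -> alpha != 0 ->
  (exists z : 'cV[int]_n, feasible A b (intmx rat z)) ->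
  exists2 z, ip_optimal rat A b c z &
    9%:R * `|dot alpha (xs - intmx rat z)| < (4 * n + 2)%:R * (Delta_alpha alpha A)%:R.
Proof.
move=> n2 rkA al0 feas.
have [_ opt] := opt_xs.
have ex : exists z, ip_optimal rat A b c z.
  by apply: (ip_optimal_exists (M := obj c xs)) feas => z fz; apply: opt.
have [z [oz zmin]] := ex_minimal excess ex.
exists z => //; rewrite -[xs - _]trmxK.
apply: (@spindle_bound m n A (xs - intmx rat z)) => //.
- exact: Delta_alpha_gt0.
- exact: minimal_lattice_free oz zmin.
- by rewrite n2 leqnn.
- exact: cone_spindle.
- by move=> i; rewrite subrr mul0mx mxE.
- exact: rank_leq_row.
Qed.

End Optimality.

(** * Transfer to an arbitrary real field *)

Section Transfer.
Variables (R : realFieldType) (m n : nat) (A : 'M[int]_(m, n)) (b : 'cV[int]_m).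
Local Notation emb := (map_mx (@ratr R)).

Lemma intmx_ratr p q (M : 'M[int]_(p, q)) : intmx R M = emb (intmx rat M).
Proof. by apply/matrixP => i j; rewrite !mxE ratr_int. Qed.

Lemma mul_ratr (x : 'cV[rat]_n) i :
  (intmx R A *m emb x) i 0 = ratr ((intmx rat A *m x) i 0).
Proof. by rewrite intmx_ratr -map_mxM mxE. Qed.

Lemma feasible_ratr (x : 'cV[rat]_n) : feasible A b (emb x) <-> feasible A b x.
Proof.
by split=> h i; have := h i; rewrite mul_ratr -(ratr_int R) ler_rat.
Qed.

Lemma obj_ratr (c x : 'cV[rat]_n) : obj c (emb x) = ratr (obj c x).
Proof.
rewrite /obj rmorph_sum /=; apply: eq_bigr => j _.
by rewrite rmorphM /= mxE -(fmorph_eq_rat idfun (c j 0)).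
Qed.

Lemma dot_ratr (alpha : 'cV[int]_n) (x : 'cV[rat]_n) : dot alpha (emb x) = ratr (dot alpha x).
Proof.
rewrite /dot rmorph_sum /=; apply: eq_bigr => j _.
by rewrite rmorphM /= mxE ratr_int.
Qed.

Lemma tight_rows_ratr (x : 'cV[rat]_n) : tight_rows A b (emb x) = emb (tight_rows A b x).
Proof.
apply/matrixP => i j; rewrite [LHS]mxE [RHS]mxE [in RHS]mxE mul_ratr -(ratr_int R) fmorph_eq.
by case: ifP => _; rewrite ?rmorph0 // intmx_ratr [LHS]mxE.
Qed.

(** A vertex is the only solution of its tight equations, a rational system. Solvability over [R]
    descends to [rat] because row space inclusion is invariant under field extension. *)
Lemma vertex_rational (xs : 'cV[R]_n) : vertex A b xs -> exists xq, xs = emb xq.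
Proof.
move=> vx; have [_ rk] := vx.
pose ti i := (intmx R A *m xs) i 0 == (b i 0)%:~R.
pose TQ : 'M[rat]_(m, n) := \matrix_(i, j) (if ti i then (A i j)%:~R else 0).
pose bQ : 'cV[rat]_m := \col_i (if ti i then (b i 0)%:~R else 0).
have TE : emb TQ = tight_rows A b xs.
  by apply/matrixP => i j; rewrite !mxE /ti; rewrite !mxE; case: ifP; rewrite ?ratr_int ?rmorph0.
have bE : emb TQ *m xs = emb bQ.
  apply/colP => i; rewrite [RHS]mxE [bQ _ _]mxE TE; case: (boolP (ti i)) => tii.
    rewrite ratr_int -(eqP tii) [LHS]mxE [RHS]mxE; apply: eq_bigr => j _.
    by rewrite [tight_rows _ _ _ _ _]mxE -/(ti i) tii.
  rewrite rmorph0 [LHS]mxE big1 // => j _.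
  by rewrite [tight_rows _ _ _ _ _]mxE -/(ti i) (negPf tii) mul0r.
have fr : row_free (emb TQ)^T by rewrite TE /row_free mxrank_tr rk.
have : ((emb bQ)^T <= (emb TQ)^T)%MS by rewrite -bE trmx_mul submxMl.
rewrite !map_trmx map_submx => /submxP[y yE].
exists y^T; apply: trmx_inj; apply: (row_free_inj fr).
by rewrite /= -trmx_mul bE [LHS]map_trmx yE map_mxM -!map_trmx trmxK.
Qed.

End Transfer.

Theorem theorem5 (R : realFieldType) (m n : nat) (A : 'M[int]_(m, n))
  (alpha : 'cV[int]_n) (b : 'cV[int]_m) (c : 'cV[rat]_n) (xs : 'cV[R]_n) :
  (2 <= n)%N ->
  \rank (intmx R A) = n ->
  alpha != 0 ->
  lp_optimal_vertex A b c xs ->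
  (exists z : 'cV[int]_n, feasible A b (intmx R z)) ->
  exists zs : 'cV[int]_n,
    ip_optimal R A b c zs /\
    `|dot alpha (xs - intmx R zs)| < ((4 * n + 2)%:R / 9%:R) * (Delta_alpha alpha A)%:R.
Proof.
move=> n2 rkA al0 [vx opt] [z0 fz0].
have [xq xsE] := vertex_rational vx; subst xs.
have opt_q : lp_optimal_vertex A b c xq.
  have [fx rkx] := vx; split=> [|y fy]; last first.
    by rewrite -(ler_rat R) -!obj_ratr; apply: opt; apply/feasible_ratr.
  split; first exact/feasible_ratr.
  by move: rkx; rewrite tight_rows_ratr mxrank_map.
have rkQ : \rank (intmx rat A) = n by rewrite -[RHS]rkA (intmx_ratr R) mxrank_map.
have feasE (z : 'cV[int]_n) : feasible A b (intmx R z) <-> feasible A b (intmx rat z).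
  by rewrite intmx_ratr; apply: feasible_ratr.
have [|z [fz oz] lt] := proximity_rat opt_q n2 rkQ al0.
  by exists z0; apply/feasE.
exists z; split.
  split; first exact/feasE.
  by move=> y /feasE /oz; rewrite !(intmx_ratr R) !obj_ratr ler_rat.
rewrite intmx_ratr -map_mxB dot_ratr -ratr_norm.
have -> : (4 * n + 2)%:R / 9%:R * (Delta_alpha alpha A)%:R =
    ratr ((4 * n + 2)%:R / 9%:R * (Delta_alpha alpha A)%:R) :> R.
  by rewrite !rmorphM /= fmorphV /= !ratr_nat.
by rewrite ltr_rat mulrAC ltr_pdivlMr // mulrC.
Qed.
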